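(* Let $N\ge2$, $0<\ell<N$, let $F,V$ be finite dimensional complex vector spaces, and let $K(x,y)\in L^1_{loc}(\mathbb{R}^N\times\mathbb{R}^N,\mathcal{L}(F,V))$ satisfy, for some positive constants $C_1,C_2$, $$|K(x,y)|\le C_1|x-y|^{\ell-N},\quad x\ne y,$$ and $$|K(x,y)-K(x,0)|\le C_2\frac{|y|}{|x|^{N-\ell+1}},\quad 2|y|\le|x|.$$ Let $1\le q<\infty$, and let $w$ be a weight and $\nu\in\mathcal{M}_+(\mathbb{R}^N)$ satisfy, for some positive constants $C_3,C_4$, $$\left(\int_{B^c(0,2|y|)}\frac{1}{|x|^{(N-\ell+1)q}}\,d\nu(x)\right)^{1/q}\le C_3\frac{w(y)}{|y|}\quad\text{for a.e. }y\in\mathbb{R}^N,$$ and $$\left(\int_{B(0,4|y|)}\frac{1}{|x-y|^{(N-\ell)q}}\,d\nu(x)\right)^{1/q}\le C_4\,w(y)\quad\text{for a.e. }y\in\mathbb{R}^N.$$ If $L(D)$ is a cocanceling homogeneous linear differential operator on $\mathbb{R}^N$ from $F$ to $V$, then there exists $C>0$ such that $$\left(\int_{\mathbb{R}^N}\left|\int_{\mathbb{R}^N}K(x,y)g(y)\,dy\right|^q d\nu(x)\right)^{1/q}\le C\int_{\mathbb{R}^N}|g(x)|w(x)\,dx$$ for all $g\in L^1_w(\mathbb{R}^N,F)$ satisfying $L(D)g=0$ in the sense of distributions.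
   Context: A homogeneous linear differential operator $L(D)=\sum_{|\alpha|=k}b_\alpha\partial^\alpha$ with constant coefficients $b_\alpha\in\mathcal{L}(F,V)$ and symbol $L(\xi)=\sum_{|\alpha|=k}b_\alpha\xi^\alpha$ is cocanceling if $\bigcap_{\xi\in\mathbb{R}^N\setminus\{0\}}\ker L(\xi)=\{0\}$. A weight is a locally integrable $w:\mathbb{R}^N\to\mathbb{R}$ with $w>0$ a.e. $L^1_w$ is the space of measurable $g$ with $\int|g|w\,dx<\infty$. $\mathcal{M}_+(\mathbb{R}^N)$ is the set of non-negative $\sigma$-finite Borel measures on $\mathbb{R}^N$. $B(x,r)$ is the open ball and $B^c(x,r)$ its complement. *)

(* Defs.v *)
From HB Require Import structures.
From mathcomp Require Import all_boot all_order all_algebra complex.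
From mathcomp Require Import all_classical all_reals all_analysis measurable_realfun.

Set Implicit Arguments.
Unset Strict Implicit.
Unset Printing Implicit Defensive.

Import Order.TTheory GRing.Theory Num.Theory.
Import numFieldNormedType.Exports.

Local Open Scope classical_set_scope.
Local Open Scope ring_scope.

(* The space R^N is the type of row vectors 'rV[R]_N, with its Borel
   sigma-algebra.  Measurable functions are Borel measurable: a kernel that is
   to be integrated against an arbitrary Borel measure in one of its variables
   has to be Borel, and for integrands with respect to the Lebesgue measure this
   is no restriction, up to modification on a null set. *)
Section borel_rV.
Variables (R : realType) (n : nat).

Definition borel_rV : set (set 'rV[R]_n) := <<s open >>.

Let borel0 : borel_rV set0.
Proof. exact: sigma_algebra0. Qed.

Let borelC A : borel_rV A -> borel_rV (~` A).
Proof. exact: sigma_algebraC. Qed.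

Let borel_bigcup (F : _^nat) :
  (forall i, borel_rV (F i)) -> borel_rV (\bigcup_i F i).
Proof. exact: sigma_algebra_bigcup. Qed.

HB.instance Definition _ := @isMeasurable.Build default_measure_display
  'rV[R]_n borel_rV borel0 borelC borel_bigcup.

Lemma open_measurable_rV (A : set 'rV[R]_n) : open A -> measurable A.
Proof. exact: sub_sigma_algebra. Qed.

Lemma measurable_coord_rV (i : 'I_n) :
  measurable_fun setT (fun x : 'rV[R]_n => x ord0 i).
Proof.
apply: (measurability _ (RGenOInfty.measurableE R)).
move=> _ [_ [a ->] <-]; rewrite setTI.
apply: open_measurable_rV; apply: open_comp; last exact: interval_open.
by move=> x _; exact: coord_continuous.
Qed.

Lemma measurable_fun_rV d (T : measurableType d) (f : T -> 'rV[R]_n) :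
  (forall i, measurable_fun setT (fun t => f t ord0 i)) ->
  measurable_fun setT f.
Proof.
move=> mf; apply: (@measurability _ _ _ _ _ _ (@open 'rV[R]_n)) => //.
move=> _ [U oU <-]; rewrite setTI.
pose P (c : {ffun 'I_n -> rat} * nat) : set 'rV[R]_n :=
  [set x | forall i, ball (ratr (c.1 i) : R) (c.2.+1%:R^-1) (x ord0 i)].
have UE : U = \bigcup_(c in [set c | P c `<=` U]) P c.
  apply/seteqP; split=> [x Ux|x [c cU Pcx]]; last exact: cU.
  have /nbhs_ballP[e /= e0 xeU] : nbhs x U by exact: open_nbhs_nbhs.
  pose k := Num.truncn (2 / e).
  have k0 : 0 < (k.+1%:R)^-1 :> R by rewrite invr_gt0.
  have ke : (k.+1%:R)^-1 *+ 2 < e :> R.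
    rewrite -[ltLHS]mulr_natl ltr_pdivrMr// mulrC -ltr_pdivrMr//.
    by rewrite Num.Theory.truncnS_gt.
  have /choice[q qx] (i : 'I_n) : exists q : rat,
      ball (x ord0 i) (k.+1%:R^-1) (ratr q : R).
    have : ball (x ord0 i) (k.+1%:R^-1) `&` range (ratr : rat -> R) !=set0.
      apply: dense_rat; last exact: ball_open.
      by exists (x ord0 i); exact: ballxx.
    by move=> [z [xz [q _ qz]]]; exists q; rewrite qz.
  exists ([ffun i => q i], k) => /=.
  - move=> y Py; apply: xeU; split=> // j i; rewrite (ord1 j).
    have := Py i; rewrite /= ffunE => qy.
    apply: le_ball (ltW ke) _ _; rewrite mulr2n.
    exact: ball_triangle (qx i) qy.
  - by move=> i; rewrite ffunE; apply: ball_sym; exact: qx.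
rewrite UE preimage_bigcup.
rewrite bigcup_mkcond.
apply: countable_bigcupT_measurable => [|c]; first exact: countableP.
case: ifP => // _.
rewrite (_ : _ @^-1` _ =
  \bigcap_(i in [set: 'I_n]) ((fun t => f t ord0 i) @^-1` ball (ratr (c.1 i) : R) (c.2.+1%:R^-1))); last first.
  by apply/seteqP; split=> [t Pt i _|t Pt i]; [exact: Pt|exact: Pt].
apply: fin_bigcap_measurable => // i _.
rewrite -[X in measurable X]setTI; apply: mf => //.
exact: measurable_ball.
Qed.

End borel_rV.

Section lebesgue_rV.
Variable R : realType.
Local Open Scope ereal_scope.

Definition cons_rV n (p : measurableTypeR R * 'rV[R]_n) : 'rV[R]_n.+1 :=
  \row_i (if unlift ord0 i is Some j then p.2 ord0 j else p.1).

Lemma measurable_cons_rV n : measurable_fun setT (@cons_rV n).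
Proof.
apply: measurable_fun_rV => i; under eq_fun do rewrite mxE.
case: unliftP => [j _|_]; last exact: measurable_fst.
exact: (measurableT_comp (measurable_coord_rV j) measurable_snd).
Qed.

Section step.
Variables (n : nat) (mu : {sigma_finite_measure set 'rV[R]_n -> \bar R}).

Definition lebesgue_rV_step : set 'rV[R]_n.+1 -> \bar R :=
  pushforward (@lebesgue_measure R \x mu) (@cons_rV n).

Let step0 : lebesgue_rV_step set0 = 0.
Proof. by rewrite /lebesgue_rV_step /pushforward preimage_set0 measure0. Qed.

Let step_ge0 A : 0 <= lebesgue_rV_step A.
Proof. exact: (measure_ge0 (@lebesgue_measure R \x mu)). Qed.

Let step_sigma_additive : semi_sigma_additive lebesgue_rV_step.
Proof.
move=> F mF tF mUF; rewrite /lebesgue_rV_step /pushforward preimage_bigcup.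
apply: measure_semi_sigma_additive.
- by move=> i; rewrite -[X in measurable X]setTI; exact: measurable_cons_rV.
- apply/trivIsetP => /= i j _ _ ij; rewrite -preimage_setI.
  by move/trivIsetP : tF => /(_ _ _ _ _ ij) ->//; rewrite preimage_set0.
- rewrite -preimage_bigcup -[X in measurable X]setTI.
  exact: measurable_cons_rV.
Qed.

HB.instance Definition _ := isMeasure.Build _ _ _ lebesgue_rV_step
  step0 step_ge0 step_sigma_additive.

Let step_sigma_finite : sigma_finite setT lebesgue_rV_step.
Proof.
have /sigma_finiteP[A [TA ndA Aoo]] := sigma_finiteT (@lebesgue_measure R).
have /sigma_finiteP[B [TB ndB Boo]] := sigma_finiteT mu.
have [G TG Goo] : sigma_finite setT (@lebesgue_measure R \x mu).
  exists (fun k => A k `*` B k).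
    apply/seteqP; split=> // -[t x] _.
    have [i _ Ait] : (\bigcup_k A k) t by rewrite -TA.
    have [j _ Bjx] : (\bigcup_k B k) x by rewrite -TB.
    exists (maxn i j) => //; split=> /=.
    - by move: t Ait; exact/subsetPset/ndA/leq_maxl.
    - by move: x Bjx; exact/subsetPset/ndB/leq_maxr.
  move=> k; have [mA Ak] := Aoo k; have [mB Bk] := Boo k.
  split; first exact: measurableX.
  by rewrite product_measure1E// lte_mul_pinfty// ge0_fin_numE.
pose uncons_rV (x : 'rV[R]_n.+1) : measurableTypeR R * 'rV[R]_n :=
  (x ord0 ord0, \row_i x ord0 (lift ord0 i)).
have unconsK : cancel uncons_rV (@cons_rV n).
  move=> x; apply/rowP => i; rewrite mxE.
  by case: unliftP => [j ->|->] /=; rewrite ?mxE.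
have consK : cancel (@cons_rV n) uncons_rV.
  move=> [t x]; rewrite /uncons_rV !mxE unlift_none; congr (_, _).
  by apply/rowP => i; rewrite !mxE liftK.
have muncons : measurable_fun setT uncons_rV.
  apply: measurable_fun_pair; first exact: measurable_coord_rV.
  apply: measurable_fun_rV => i; under eq_fun do rewrite mxE.
  exact: measurable_coord_rV.
exists (fun k => uncons_rV @^-1` G k); first by rewrite -preimage_bigcup -TG.
move=> k; have [mGk Gkoo] := Goo k; split.
  by rewrite -[X in measurable X]setTI; exact: muncons.
rewrite /lebesgue_rV_step /pushforward -comp_preimage.
by rewrite (_ : _ \o _ = id)//; apply/funext => p /=; rewrite consK.
Qed.

HB.instance Definition _ := Measure_isSigmaFinite.Build _ _ _ lebesgue_rV_step
  step_sigma_finite.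

End step.

(* The N-dimensional Lebesgue measure, as an iterated product measure carried to
   row vectors; lebesgue_rV_box computes it on boxes. *)
Fixpoint lebesgue_rV n : {sigma_finite_measure set 'rV[R]_n -> \bar R} :=
  match n with
  | 0 => \d_ (0%R : 'rV[R]_0)
  | n'.+1 => lebesgue_rV_step (lebesgue_rV n')
  end.

Lemma lebesgue_rV_box n (A : 'I_n -> set R) : (forall i, measurable (A i)) ->
  lebesgue_rV n [set x | forall i, A i (x ord0 i)] =
    \prod_(i < n) lebesgue_measure (A i).
Proof.
elim: n A => [|n IH] A mA.
  rewrite big_ord0 /= diracE mem_set// => -[].
  done.
pose B := [set x : 'rV[R]_n | forall i, A (lift ord0 i) (x ord0 i)].
have mB : measurable B.
  rewrite (_ : B = \bigcap_(i in [set: 'I_n])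
      ((fun x : 'rV[R]_n => x ord0 i) @^-1` A (lift ord0 i))); last first.
    by apply/seteqP; split=> [x Bx i _|x Bx i]; exact: Bx.
  apply: fin_bigcap_measurable => // i _.
  by rewrite -[X in measurable X]setTI; apply: measurable_coord_rV => //; exact: mA.
rewrite big_ord_recl -(IH (A \o lift ord0))//=.
rewrite -(@product_measure1E _ _ _ _ _ (@lebesgue_measure R) (lebesgue_rV n))//; last exact: mA.
rewrite /lebesgue_rV_step /pushforward; congr (product_measure1 _ _ _).
apply/seteqP; split=> [[t x] /= Atx|[t x] /= [At Ax] i].
- split=> [|i].
  + by have := Atx ord0; rewrite mxE unlift_none.
  + by have := Atx (lift ord0 i); rewrite mxE liftK.
- by rewrite mxE; case: unliftP => [j ->|->].
Qed.

End lebesgue_rV.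

Section euclidean.
Variables (R : realType) (n : nat).
Implicit Types x y : 'rV[R]_n.

(* The library norm `|x| on row vectors is the sup norm. *)
Definition enorm x : R := Num.sqrt (\sum_(i < n) x ord0 i ^+ 2).

Definition eball x (r : R) : set 'rV[R]_n := [set y | enorm (y - x) < r].

End euclidean.

Section complex_vector_spaces.
Variable R : realType.
Local Notation C := R[i].

(* A finite dimensional complex vector space is a vectType over R[i]; it carries
   no canonical norm, so that norms on such spaces are explicit parameters. *)
Definition is_norm (E : vectType C) (p : E -> R) : Prop :=
  [/\ forall x, p x = 0 -> x = 0,
      forall x y, p (x + y) <= p x + p y &
      forall (c : C) x, p (c *: x) = complex.Re `|c| * p x].

Definition op_norm (E1 E2 : vectType C) (p1 : E1 -> R) (p2 : E2 -> R)
    (A : 'Hom(E1, E2)) : R :=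
  sup [set p2 (A v) | v in [set v | p1 v <= 1]].

Section integration.
Context d (T : measurableType d) (E : vectType C).
Implicit Types (mu : {measure set T -> \bar R}) (D : set T) (f : T -> E).

(* Coordinates in the basis vbasis fullv of E; the notions below do not depend on
   the choice of a basis. *)
Definition re_coord f (j : 'I_(\dim {:E})) (x : T) : R :=
  complex.Re (coord (vbasis {:E}) j (f x)).

Definition im_coord f (j : 'I_(\dim {:E})) (x : T) : R :=
  complex.Im (coord (vbasis {:E}) j (f x)).

Definition vmeasurable f : Prop := forall j,
  measurable_fun setT (re_coord f j) /\ measurable_fun setT (im_coord f j).

Definition vintegrable mu D f : Prop := forall j,
  mu.-integrable D (EFin \o re_coord f j) /\
  mu.-integrable D (EFin \o im_coord f j).

Definition vintegral mu f : E :=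
  \sum_j ((\int[mu]_x re_coord f j x) +i* (\int[mu]_x im_coord f j x))%C
    *: (vbasis {:E})`_j.

End integration.

Definition vlocally_integrable N (E : vectType C) (f : 'rV[R]_N -> E) : Prop :=
  vmeasurable f /\
  forall A, compact A -> vintegrable (lebesgue_rV R N) A f.

Definition vlocally_integrable2 N (E : vectType C)
    (f : 'rV[R]_N * 'rV[R]_N -> E) : Prop :=
  vmeasurable f /\
  forall A, compact A -> vintegrable (lebesgue_rV R N \x lebesgue_rV R N)%E A f.

End complex_vector_spaces.

Section weights.
Context (R : realType) (N : nat).
Local Notation mu := (lebesgue_rV R N).

Definition is_weight (w : 'rV[R]_N -> R) : Prop :=
  [/\ measurable_fun setT w,
      forall A, compact A -> mu.-integrable A (EFin \o w) &
      {ae mu, forall x, 0 < w x}].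

Definition in_weighted_L1 (E : vectType R[i]) (p : E -> R) (w : 'rV[R]_N -> R)
    (g : 'rV[R]_N -> E) : Prop :=
  vmeasurable g /\ (\int[mu]_x (p (g x) * w x)%:E < +oo)%E.

End weights.

Section differential_operators.
Context (R : realType) (N k : nat).
Local Notation C := R[i].

(* Multi-indices with entries at most k; among them, those of degree k are all
   the multi-indices alpha with |alpha| = k. *)
Definition multi_index := {ffun 'I_N -> 'I_k.+1}.

Definition mdegree (alpha : multi_index) : nat := (\sum_i alpha i)%N.

Definition monomial_at (alpha : multi_index) (xi : 'rV[R]_N) : R :=
  \prod_i xi ord0 i ^+ alpha i.

Definition partial (i : 'I_N) (phi : 'rV[R]_N -> R) : 'rV[R]_N -> R :=
  fun x => 'D_(delta_mx ord0 i) phi x.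

Definition mpartial (alpha : multi_index) (phi : 'rV[R]_N -> R) :
    'rV[R]_N -> R :=
  foldr (fun i psi => iter (alpha i) (partial i) psi) phi (enum 'I_N).

Definition smooth (phi : 'rV[R]_N -> R) : Prop :=
  forall s : seq 'I_N, let psi := foldr partial phi s in
    continuous psi /\ forall i x, derivable psi x (delta_mx ord0 i).

Definition test_function (phi : 'rV[R]_N -> R) : Prop :=
  smooth phi /\ compact (closure [set x | phi x != 0]).

Variables (F V : vectType C).

(* A homogeneous operator L(D) of order k is given by its coefficients b alpha
   for |alpha| = k; the values of b at other multi-indices are irrelevant. *)
Implicit Types b : multi_index -> 'Hom(F, V).

Definition symbol b (xi : 'rV[R]_N) : 'Hom(F, V) :=
  \sum_(alpha | mdegree alpha == k) (monomial_at alpha xi)%:C%C *: b alpha.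

Definition cocanceling b : Prop :=
  \bigcap_(xi in [set xi | xi != 0]) [set v : F | v \in lker (symbol b xi)] =
  [set 0].

(* L(D) g = 0 in the sense of distributions; g must be locally integrable to
   define a distribution. *)
Definition distributional_kernel b (g : 'rV[R]_N -> F) : Prop :=
  vlocally_integrable g /\
  forall phi, test_function phi ->
    \sum_(alpha | mdegree alpha == k) (-1) ^+ mdegree alpha *:
      vintegral (lebesgue_rV R N)
        (fun x => (mpartial alpha phi x)%:C%C *: b alpha (g x)) = 0.

End differential_operators.

(* Main.v *)
(* With psi a cutoff equal to 1 at the origin and r = |x|, write
     int K(x,y) g(y) dy = int [K(x,y) - psi(y/r) K(x,0)] g(y) dy
                          + K(x,0) int psi(y/r) g(y) dy.
   The first kernel is at most a constant times k(x,y), equal to |y| |x|^(l-N-1)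
   where 2|y| <= |x| and to |x-y|^(l-N) elsewhere.  In the second term, testing
   L(D) g = 0 against y^alpha psi(y/r), |alpha| = k, gives alpha! b_alpha applied
   to int psi(y/r) g up to integrals of g against functions bounded by |y|/r and
   supported in 2|y| <= r; since L(D) is cocanceling, the b_alpha v jointly
   control v, so this term is also bounded by int k(x,y) |g(y)| dy.  Minkowski's
   integral inequality in L^q(nu), with the two conditions on w and nu, bounds
   the L^q(nu) norm of that integral by int |g| w. *)
Require Import Defs.
From HB Require Import structures.
From mathcomp Require Import all_boot all_order all_algebra complex.
From mathcomp Require Import all_classical all_reals all_analysis measurable_realfun.
From mathcomp Require Import ring.
Set Implicit Arguments.
Unset Strict Implicit.
Unset Printing Implicit Defensive.
Import Order.TTheory GRing.Theory Num.Theory.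
Import numFieldNormedType.Exports.
Local Open Scope classical_set_scope.
Local Open Scope ring_scope.

(** * Real coordinates and norms on complex vector spaces *)

Section real_coordinates.
Context (R : realType) (E : vectType R[i]).
Local Notation C := R[i].
Local Notation n := (\dim {:E}).
Local Notation e := (vbasis {:E}).

(** The norms on F and V are arbitrary while integrals are defined by coordinates, so the estimates
    are made in [coord_norm], for which the norm of an integral is at most the integral of the norm.
    The given norms enter through equivalence of norms, which also makes cocancellation
    quantitative: v |-> sum of |b_alpha v| vanishes only at 0, so it is a norm on F and dominates v.
    The test functions are products of functions of one variable whose derivatives are all given by
    formulas. A derivative of order beta of y^alpha psi(y/r), |beta| = |alpha|, can thus be
    evaluated at the origin, where it is alpha! if beta = alpha and 0 otherwise; equality of order
    and degree makes it a function of y/r alone, so the constants do not depend on r. The inner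
    integral need not exist at every x. The pointwise bound is proved where int k(x,y) |g(y)| dy is
    finite, and Minkowski's inequality shows that this holds for nu-almost every x. *)

Definition rcoord (j : 'I_n) (v : E) : R := complex.Re (coord e j v).
Definition icoord (j : 'I_n) (v : E) : R := complex.Im (coord e j v).

(* Homogeneous under real scalars only, so not a norm in the sense of [is_norm]. *)
Definition coord_norm (v : E) : R := \sum_j (`|rcoord j v| + `|icoord j v|).

Definition real_linear (W : lmodType C) (phi : E -> W) : Prop :=
  (forall u v, phi (u + v) = phi u + phi v) /\
  (forall (t : R) v, phi (t%:C%C *: v) = t%:C%C *: phi v).

(** Linearity over the reals only: the basic instances [rcoord] and [icoord] are not complex
    linear. *)
Definition real_functional (phi : E -> R) : Prop :=
  (forall u v, phi (u + v) = phi u + phi v) /\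
  (forall (t : R) v, phi (t%:C%C *: v) = t * phi v).

Lemma ReZ (t : R) (z : C) : complex.Re (t%:C%C * z) = t * complex.Re z.
Proof. by case: z => a b; simpc. Qed.

Lemma ImZ (t : R) (z : C) : complex.Im (t%:C%C * z) = t * complex.Im z.
Proof. by case: z => a b; simpc. Qed.

Lemma rcoord_functional j : real_functional (rcoord j).
Proof.
split=> [u v|t v]; first by rewrite /rcoord linearD raddfD.
by rewrite /rcoord linearZ ReZ.
Qed.

Lemma icoord_functional j : real_functional (icoord j).
Proof.
split=> [u v|t v]; first by rewrite /icoord linearD raddfD.
by rewrite /icoord linearZ ImZ.
Qed.

Lemma complexE (z : C) : z = (complex.Re z)%:C%C + 'i%C * (complex.Im z)%:C%C.
Proof. by case: z => a b; simpc. Qed.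

(** The vectors e_j and i e_j form a basis of E over the reals; this reduces every real functional
    to the coordinates. *)
Lemma sum_real_coord (v : E) :
  v = \sum_j ((rcoord j v)%:C%C *: e`_j + (icoord j v)%:C%C *: ('i%C *: e`_j)).
Proof.
rewrite {1}(coord_vbasis (memvf v)); apply: eq_bigr => j _.
by rewrite {1}[coord e j v]complexE scalerDl scalerA mulrC.
Qed.

Lemma real_functional0 phi : real_functional phi -> phi 0 = 0.
Proof. by case=> + _ => /(_ 0 0); rewrite addr0 => /eqP; rewrite -subr_eq subrr eq_sym => /eqP. Qed.

Lemma real_functionalE phi v : real_functional phi ->
  phi v = \sum_j (rcoord j v * phi e`_j + icoord j v * phi ('i%C *: e`_j)).
Proof.
move=> phil; have phi0 := real_functional0 phil; have [phiD phiZ] := phil.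
rewrite {1}(sum_real_coord v) (big_morph phi phiD phi0).
by apply: eq_bigr => j _; rewrite phiD !phiZ.
Qed.

Lemma coord_norm_ge0 v : 0 <= coord_norm v.
Proof. by apply: sumr_ge0 => j _; rewrite addr_ge0. Qed.

Lemma rcoord_le j v : `|rcoord j v| <= coord_norm v.
Proof.
rewrite /coord_norm (bigD1 j)//= -addrA lerDl addr_ge0//.
by apply: sumr_ge0 => i _; rewrite addr_ge0.
Qed.

Lemma icoord_le j v : `|icoord j v| <= coord_norm v.
Proof.
rewrite /coord_norm (bigD1 j)//= addrAC lerDr addr_ge0//.
by apply: sumr_ge0 => i _; rewrite addr_ge0.
Qed.

Section seminorm.
Variable p : E -> R.
Hypothesis pD : forall x y, p (x + y) <= p x + p y.
Hypothesis pZ : forall (c : C) x, p (c *: x) = complex.Re `|c| * p x.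

Lemma seminormZr (t : R) x : p (t%:C%C *: x) = `|t| * p x.
Proof. by rewrite pZ normc_def/= expr0n addr0 sqrtr_sqr. Qed.

Lemma seminormZi x : p ('i%C *: x) = p x.
Proof. by rewrite pZ normc_def/= expr0n expr1n add0r sqrtr1 mul1r. Qed.

Lemma seminorm0 : p 0 = 0.
Proof. by rewrite -(scale0r (0 : E)) pZ normr0 mul0r. Qed.

Lemma seminormN x : p (- x) = p x.
Proof.
have := seminormZr (-1) x; rewrite normrN normr1 mul1r => <-.
by rewrite rmorphN rmorph1 scaleN1r.
Qed.

Lemma seminorm_ge0 x : 0 <= p x.
Proof.
have := pD x (- x); rewrite subrr seminorm0 seminormN -mulr2n.
by rewrite pmulrn_lge0.
Qed.

Lemma seminorm_dist x y : `|p x - p y| <= p (x - y).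
Proof.
rewrite ler_norml; apply/andP; split.
  rewrite lerNl opprB lerBlDr -(seminormN (x - y)) opprB.
  by rewrite (le_trans _ (pD _ _))// subrK.
by rewrite lerBlDr (le_trans _ (pD _ _))// subrK.
Qed.

Lemma seminorm_sum I (r : seq I) (P : pred I) (f : I -> E) :
  p (\sum_(i <- r | P i) f i) <= \sum_(i <- r | P i) p (f i).
Proof.
elim/big_ind2 : _ => [|x a y b xa yb|//]; first by rewrite seminorm0.
by rewrite (le_trans (pD _ _))// lerD.
Qed.

(** Stated for seminorms because it is also applied to v |-> nV (A v), which may vanish on nonzero
    vectors. Since p (i e_j) = p (e_j), the values on the complex basis suffice; the added 1 keeps
    the constant positive. *)
Lemma seminorm_le_coord_norm :
  exists2 M, 0 < M & forall v, p v <= M * coord_norm v.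
Proof.
exists (1 + \sum_(j < n) p e`_j).
  by rewrite ltr_pwDl// sumr_ge0// => j _; exact: seminorm_ge0.
move=> v; rewrite {1}(sum_real_coord v) (le_trans (seminorm_sum _ _ _))//.
rewrite /coord_norm mulr_sumr ler_sum// => j _.
rewrite (le_trans (pD _ _))// !seminormZr seminormZi -mulrDl mulrC ler_wpM2r//.
rewrite (bigD1 j)//= addrCA lerDl addr_ge0// sumr_ge0// => i _.
exact: seminorm_ge0.
Qed.

End seminorm.

(** Identifies E with R^(2n), where compactness of the unit sphere and Borel measurability of
    continuous functions can be used. *)
Definition of_coords (x : 'rV[R]_(n + n)) : E :=
  \sum_j (x ord0 (lshift n j) +i* x ord0 (rshift n j))%C *: e`_j.

Definition to_coords (v : E) : 'rV[R]_(n + n) :=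
  row_mx (\row_j rcoord j v) (\row_j icoord j v).

Lemma to_coordsK : cancel to_coords of_coords.
Proof.
move=> v; rewrite [RHS](coord_vbasis (memvf v)); apply: eq_bigr => j _.
rewrite row_mxEl row_mxEr !mxE; congr (_ *: _).
by rewrite /rcoord /icoord; case: (coord _ _ _).
Qed.

Lemma of_coordsK : cancel of_coords to_coords.
Proof.
move=> x; apply/rowP => i; rewrite -(splitK i); case: (fintype.split i) => j /=.
  by rewrite row_mxEl !mxE /rcoord coord_sum_free// (basis_free (vbasisP _)).
by rewrite row_mxEr !mxE /icoord coord_sum_free// (basis_free (vbasisP _)).
Qed.

Lemma of_coordsB x y : of_coords (x - y) = of_coords x - of_coords y.
Proof.
rewrite /of_coords -sumrB; apply: eq_bigr => j _.
by rewrite -scalerBl !mxE; congr (_ *: _); simpc.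
Qed.

Lemma of_coordsZ t x : of_coords (t *: x) = t%:C%C *: of_coords x.
Proof.
rewrite /of_coords scaler_sumr; apply: eq_bigr => j _.
by rewrite scalerA !mxE; congr (_ *: _); simpc.
Qed.

Lemma coord_norm_of_coords x : coord_norm (of_coords x) <= n.*2%:R * `|x|.
Proof.
have xi i : `|x ord0 i| <= `|x|.
  rewrite [leRHS]/Num.norm/= mx_normrE.
  exact: (le_bigmax _ (fun ij : 'I_1 * 'I_(n + n) => `|x ij.1 ij.2|) (ord0, i)).
rewrite /coord_norm (@le_trans _ _ (\sum_(j < n) (`|x| + `|x|)))//.
  apply: ler_sum => j _.
  have := congr1 (fun y : 'rV_(n + n) => y ord0 (lshift n j)) (of_coordsK x).
  have := congr1 (fun y : 'rV_(n + n) => y ord0 (rshift n j)) (of_coordsK x).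
  by rewrite /= row_mxEl row_mxEr !mxE => -> ->; rewrite lerD.
by rewrite sumr_const card_ord -mulr2n -mulrnA mul2n mulr_natl.
Qed.

Section norm.
Variables (p : E -> R) (pnorm : is_norm p).

Let pD x y : p (x + y) <= p x + p y. Proof. by case: pnorm => _ + _; exact. Qed.
Let pZ (c : C) x : p (c *: x) = complex.Re `|c| * p x.
Proof. by case: pnorm => _ _; exact. Qed.
Let p0_eq0 x : p x = 0 -> x = 0. Proof. by case: pnorm => + _ _; exact. Qed.

Lemma continuous_norm_of_coords : continuous (p \o of_coords).
Proof.
have [M M0 Mp] := seminorm_le_coord_norm pD pZ.
pose L := M * n.*2%:R + 1.
have L0 : 0 < L by rewrite ltr_wpDl// mulr_ge0// ltW.
move=> x; apply/(@cvgrPdist_le _ _ _ _ (nbhs_filter (x : 'rV[R]_(n + n)))).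
move=> eps e0; near=> y.
apply: (le_trans (seminorm_dist pD pZ _ _)); rewrite -of_coordsB.
apply: (le_trans (Mp _)).
apply: (@le_trans _ _ (L * `|x - y|)).
  rewrite /L mulrDl mul1r (@le_trans _ _ (M * n.*2%:R * `|x - y|)) ?lerDl//.
  by rewrite -mulrA ler_wpM2l ?(ltW M0)// coord_norm_of_coords.
rewrite mulrC -ler_pdivlMr//; near: y.
have := @cvgr_dist_le _ _ _ _ (nbhs_filter (x : 'rV[R]_(n + n))) id x cvg_id (eps / L).
by apply; rewrite divr_gt0.
Unshelve. all: by end_near. Qed.

(** Compactness: p is continuous and positive on the unit sphere of the sup norm, so it has a
    positive minimum there, and homogeneity extends the bound to all vectors. *)
Lemma coord_norm_le_norm : exists2 M, 0 < M & forall v, coord_norm v <= M * p v.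
Proof.
(* In dimension 0 the unit sphere is empty and offers no minimum point. *)
have [n0|n0] := posnP (n + n).
  have no_index (j : 'I_n) : False.
    have n1 := leq_ltn_trans (leq0n j) (ltn_ord j).
    by have := leq_trans n1 (leq_addr n n); rewrite n0.
  exists 1 => // v; rewrite /coord_norm big1 => [|j]; last by case: (no_index j).
  by rewrite mul1r (seminorm_ge0 pD pZ).
pose S := [set x : 'rV[R]_(n + n) | `|x| = 1].
have S0 : S !=set0.
  exists (const_mx 1); rewrite /S/= [LHS]/Num.norm/= mx_normrE.
  apply/eqP; rewrite eq_le; apply/andP; split.
    by apply/bigmax_leP; split => // ij _; rewrite mxE normr1.
  apply/bigmax_geP; right => /=; exists (ord0, Ordinal n0) => //.
  by rewrite mxE normr1.
have cS : compact S.
  apply: bounded_closed_compact.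
    by exists 1; split; [exact: num_real|move=> M M1 x /= ->; exact: ltW].
  rewrite (_ : S = (fun x : 'rV[R]_(n + n) => `|x|) @^-1` [set 1])//.
  apply: closed_comp; last exact: closed_eq.
  by move=> x _; exact: norm_continuous.
have [x0 /set_mem Sx0 x0min] := EVT_min_rV S0 cS
  (continuous_subspaceT continuous_norm_of_coords).
have m0 : 0 < p (of_coords x0).
  rewrite lt_neqAle (seminorm_ge0 pD pZ) andbT eq_sym; apply/eqP => /p0_eq0 x00.
  have x0_0 : x0 = 0.
    rewrite -(of_coordsK x0) x00; apply/rowP => i; rewrite -(splitK i).
    case: (fintype.split i) => j /=; rewrite ?row_mxEl ?row_mxEr !mxE.
      exact: real_functional0 (rcoord_functional j).
    exact: real_functional0 (icoord_functional j).
  by move: Sx0; rewrite /S/= x0_0 normr0 => /eqP; rewrite eq_sym oner_eq0.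
exists (n.*2%:R / p (of_coords x0) + 1) => [|v].
  by rewrite ltr_wpDl// divr_ge0// ltW.
have [->|v0] := eqVneq v 0.
  rewrite (seminorm0 pZ) mulr0 /coord_norm big1// => j _.
  by rewrite !(real_functional0 (rcoord_functional j))
    !(real_functional0 (icoord_functional j)) normr0 addr0.
pose x := to_coords v; have x0' : 0 < `|x|.
  rewrite normr_gt0; apply: contra v0 => /eqP x00.
  by rewrite -(to_coordsK v) -/x x00 -(scale0r (0 : 'rV[R]_(n + n))) of_coordsZ scale0r.
have key : p (of_coords x0) * `|x| <= p v.
  rewrite -ler_pdivlMr//.
  have /x0min : (`|x|^-1 *: x) \in S.
    by apply/mem_set; rewrite /S/= normrZ normfV normr_id mulVf ?gt_eqF.
  rewrite /= of_coordsZ (seminormZr pZ) normfV normr_id to_coordsK.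
  by rewrite mulrC.
rewrite -{1}(to_coordsK v) (le_trans (coord_norm_of_coords _))//.
rewrite mulrDl mul1r -/x (@le_trans _ _ (n.*2%:R / p (of_coords x0) * p v))//.
  by rewrite -mulrA ler_wpM2l// ler_pdivlMl.
by rewrite lerDl (seminorm_ge0 pD pZ).
Unshelve. all: by end_near. Qed.

End norm.
End real_coordinates.

(** * Vector-valued integrals *)

Section vector_integral.
Context (R : realType) d (T : measurableType d).
Implicit Types (mu : {measure set T -> \bar R}) (E W : vectType R[i]).

Lemma Rintegral_sum mu (I : Type) (s : seq I) (h : I -> T -> R) :
  (forall i, mu.-integrable setT (EFin \o h i)) ->
  \int[mu]_x (\sum_(i <- s) h i x) = \sum_(i <- s) \int[mu]_x h i x.
Proof.
move=> ih; elim: s => [|i s IH].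
  by rewrite big_nil; under eq_Rintegral do rewrite big_nil; rewrite /Rintegral integral0.
rewrite big_cons -IH -RintegralD//.
  by apply: eq_Rintegral => x _; rewrite big_cons.
apply: (eq_integrable _ (fun x => \sum_(i <- s) (h i x)%:E)%E) => //.
  by move=> x _; rewrite /= sumEFin.
by apply: integrable_sum => // j _; exact: ih.
Qed.

Section functional.
Variables (E : vectType R[i]) (phi : E -> R).
Hypothesis phil : real_functional phi.
Variables (mu : {measure set T -> \bar R}) (f : T -> E).

Let h (j : 'I_(\dim {:E}) ) x := re_coord f j x * phi (vbasis {:E})`_j +
  im_coord f j x * phi ('i%C *: (vbasis {:E})`_j).

Let phif x : phi (f x) = \sum_j h j x.
Proof. exact: real_functionalE. Qed.

Lemma measurable_functional : vmeasurable f -> measurable_fun setT (phi \o f).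
Proof.
move=> mf; rewrite (_ : phi \o f = fun x => \sum_j h j x); last exact/funext.
apply: measurable_sum => j; have [mr mi] := mf j.
by apply: measurable_funD; apply: measurable_funM.
Qed.

Let ih D (mD : measurable D) : vintegrable mu D f -> forall j, mu.-integrable D (EFin \o h j).
Proof.
move=> vf j; have [ir ii] := vf j.
rewrite (_ : _ \o _ = ((fun x => (EFin (phi (vbasis {:E})`_j)) * (EFin \o re_coord f j) x) \+
  (fun x => (EFin (phi ('i%C *: (vbasis {:E})`_j))) * (EFin \o im_coord f j) x)))%E.
  by apply: integrableD => //; exact: integrableZl.
by apply/funext => x; rewrite /h /= !EFinD !EFinM muleC; congr (_ + _)%E; rewrite muleC.
Qed.

Lemma integrable_functional D : measurable D -> vintegrable mu D f ->
  mu.-integrable D (EFin \o (phi \o f)).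
Proof.
move=> mD /(ih mD) hi.
apply: (eq_integrable _ (fun x => \sum_j (h j x)%:E)%E) => //.
  by move=> x _; rewrite /= sumEFin phif.
by apply: integrable_sum => // j _; exact: hi.
Qed.

(** A real functional is a fixed real combination of the coordinates, and [vintegral] integrates
    each of these. The further properties of [vintegral] follow by testing against functionals. *)
Lemma functional_vintegral : vintegrable mu setT f ->
  phi (vintegral mu f) = \int[mu]_x phi (f x).
Proof.
move=> vf; have hi := ih measurableT vf.
have [phiD phiZ] := phil.
rewrite (_ : \int[mu]_x _ = \int[mu]_x (\sum_j h j x)); last first.
  by apply: eq_Rintegral => x _; exact: phif.
rewrite Rintegral_sum// /vintegral (big_morph phi phiD (real_functional0 phil)).
apply: eq_bigr => j _; have [ir ii] := vf j.
rewrite RintegralD//; last 2 first.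
- have := integrableZr measurableT (phi (vbasis {:E})`_j) ir.
  by apply: eq_integrable.
- have := integrableZr measurableT (phi ('i%C *: (vbasis {:E})`_j)) ii.
  by apply: eq_integrable.
rewrite !RintegralZr// (complexE (_ +i* _)%C)/= scalerDl phiD phiZ.
by rewrite [('i * _)%C]mulrC -scalerA phiZ.
Qed.

End functional.

Lemma rcoord_vintegral mu E (f : T -> E) j : vintegrable mu setT f ->
  rcoord j (vintegral mu f) = \int[mu]_x rcoord j (f x).
Proof. exact/functional_vintegral/rcoord_functional. Qed.

Lemma icoord_vintegral mu E (f : T -> E) j : vintegrable mu setT f ->
  icoord j (vintegral mu f) = \int[mu]_x icoord j (f x).
Proof. exact/functional_vintegral/icoord_functional. Qed.

Lemma coord_ext E (u v : E) : (forall j, rcoord j u = rcoord j v) ->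
  (forall j, icoord j u = icoord j v) -> u = v.
Proof.
move=> r i; rewrite (sum_real_coord u) (sum_real_coord v).
by apply: eq_bigr => j _; rewrite r i.
Qed.

Lemma real_functional_comp E W (A : E -> W) (phi : W -> R) :
  real_linear A -> real_functional phi -> real_functional (phi \o A).
Proof.
by move=> [AD AZ] [phiD phiZ]; split=> [u v|t v] /=; rewrite ?AD ?AZ ?phiD ?phiZ.
Qed.

Lemma real_linear_hom E W (A : 'Hom(E, W)) : real_linear A.
Proof. by split=> [u v|t v]; rewrite ?linearD ?linearZ. Qed.

Lemma real_linear_scale E (t : R) : real_linear (fun v : E => t%:C%C *: v).
Proof. by split=> [u v|s v]; rewrite ?scalerDr// !scalerA mulrC. Qed.

Section real_linear_map.
Variables (E W : vectType R[i]) (A : E -> W) (Al : real_linear A).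

Lemma vmeasurable_linear (f : T -> E) : vmeasurable f -> vmeasurable (A \o f).
Proof.
move=> mf j; split.
  exact: (measurable_functional (real_functional_comp Al (rcoord_functional j))).
exact: (measurable_functional (real_functional_comp Al (icoord_functional j))).
Qed.

Lemma vintegrable_linear mu D (f : T -> E) : measurable D ->
  vintegrable mu D f -> vintegrable mu D (A \o f).
Proof.
move=> mD vf j; split.
  exact: (integrable_functional (real_functional_comp Al (rcoord_functional j))).
exact: (integrable_functional (real_functional_comp Al (icoord_functional j))).
Qed.

(** A coordinate composed with a real linear map is again a real functional, so both sides have the
    same coordinates. *)
Lemma vintegral_linear mu (f : T -> E) : vintegrable mu setT f ->
  vintegral mu (A \o f) = A (vintegral mu f).
Proof.
move=> vf; have vAf := vintegrable_linear measurableT vf.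
apply: coord_ext => j.
  rewrite rcoord_vintegral//; apply/esym.
  exact: (functional_vintegral (real_functional_comp Al (rcoord_functional j))).
rewrite icoord_vintegral//; apply/esym.
exact: (functional_vintegral (real_functional_comp Al (icoord_functional j))).
Qed.

End real_linear_map.

Lemma vintegrableD mu E D (f g : T -> E) : measurable D ->
  vintegrable mu D f -> vintegrable mu D g -> vintegrable mu D (f \+ g).
Proof.
move=> mD vf vg j; have [rf jf] := vf j; have [rg jg] := vg j; split.
  apply: (eq_integrable _ ((EFin \o re_coord f j) \+ (EFin \o re_coord g j))%E) => //.
    by move=> x _; rewrite /= -EFinD -(rcoord_functional j).1.
  exact: integrableD.
apply: (eq_integrable _ ((EFin \o im_coord f j) \+ (EFin \o im_coord g j))%E) => //.
  by move=> x _; rewrite /= -EFinD -(icoord_functional j).1.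
exact: integrableD.
Qed.

Lemma vintegralD mu E (f g : T -> E) :
  vintegrable mu setT f -> vintegrable mu setT g ->
  vintegral mu (f \+ g) = vintegral mu f + vintegral mu g.
Proof.
move=> vf vg; have vfg := vintegrableD measurableT vf vg; apply: coord_ext => j.
  rewrite (rcoord_functional j).1 !rcoord_vintegral// -RintegralD//.
  - by apply: eq_Rintegral => x _; rewrite -(rcoord_functional j).1.
  - exact: (vf j).1.
  - exact: (vg j).1.
rewrite (icoord_functional j).1 !icoord_vintegral// -RintegralD//.
- by apply: eq_Rintegral => x _; rewrite -(icoord_functional j).1.
- exact: (vf j).2.
- exact: (vg j).2.
Qed.

Lemma measurable_coord_norm E (f : T -> E) : vmeasurable f ->
  measurable_fun setT (fun x => coord_norm (f x)).
Proof.
move=> mf; apply: measurable_sum => j; have [mr mi] := mf j.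
by apply: measurable_funD; apply: measurableT_comp.
Qed.

Lemma vintegrable_bounded mu E D (f : T -> E) (h : T -> \bar R) : measurable D ->
  vmeasurable f -> mu.-integrable D h ->
  (forall x, D x -> ((coord_norm (f x))%:E <= h x)%E) -> vintegrable mu D f.
Proof.
move=> mD mf ih fh j; have [mr mi] := mf j; split.
  apply: (le_integrable mD _ _ ih) => [|x Dx /=].
    by apply/measurable_EFinP; exact: measurable_funTS.
  rewrite (le_trans _ (lee_abs _))// (le_trans _ (fh x Dx))// lee_fin.
  exact: rcoord_le.
apply: (le_integrable mD _ _ ih) => [|x Dx /=].
  by apply/measurable_EFinP; exact: measurable_funTS.
rewrite (le_trans _ (lee_abs _))// (le_trans _ (fh x Dx))// lee_fin.
exact: icoord_le.
Qed.

Lemma integrable_coord_norm mu E D (f : T -> E) : measurable D ->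
  vintegrable mu D f -> mu.-integrable D (fun x => (coord_norm (f x))%:E).
Proof.
move=> mD vf.
apply: (eq_integrable _ (fun x => \sum_j (`|(re_coord f j x)%:E| + `|(im_coord f j x)%:E|))%E) => //.
  by move=> x _; rewrite /= sumEFin.
apply: integrable_sum => // j _; have [ir ii] := vf j.
by apply: integrableD => //; apply: integrable_abse.
Qed.

(** The l1 form of [coord_norm] gives the constant 1: the scalar triangle inequality is summed over
    the coordinates. *)
Lemma coord_norm_vintegral mu E (f : T -> E) : vintegrable mu setT f ->
  ((coord_norm (vintegral mu f))%:E <= \int[mu]_x (coord_norm (f x))%:E)%E.
Proof.
move=> vf; have icn := integrable_coord_norm measurableT vf.
rewrite -[leRHS]fineK; last exact: integrable_fin_num.
rewrite lee_fin -/(Rintegral mu setT (fun x => coord_norm (f x))).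
have ia j : mu.-integrable setT (EFin \o (fun x => `|rcoord j (f x)|)).
  by have [/integrable_abse] := vf j.
have ib j : mu.-integrable setT (EFin \o (fun x => `|icoord j (f x)|)).
  by have [_ /integrable_abse] := vf j.
rewrite Rintegral_sum => [|j]; last first.
  have := integrableD measurableT (ia j) (ib j).
  by apply: eq_integrable.
apply: ler_sum => j _; rewrite RintegralD// rcoord_vintegral// icoord_vintegral//.
by have [ir ii] := vf j; apply: lerD; exact: le_normr_Rintegral.
Qed.

End vector_integral.

(** * Measurability of norms and of operators applied to vectors *)

Section measurability.
Context (R : realType) d (T : measurableType d).

Lemma continuous_measurable_rV n (f : 'rV[R]_n -> R) :
  continuous f -> measurable_fun setT f.
Proof.
move=> cf; apply: (measurability _ (RGenOInfty.measurableE R)).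
move=> _ [_ [a ->] <-]; rewrite setTI.
apply: open_measurable_rV; apply: open_comp; last exact: interval_open.
by move=> x _; exact: cf.
Qed.

(** Factors through R^(2n): there p is continuous, hence Borel, and the row of real coordinates of f
    is measurable. *)
Lemma measurable_norm (E : vectType R[i]) (p : E -> R) (f : T -> E) :
  is_norm p -> vmeasurable f -> measurable_fun setT (p \o f).
Proof.
move=> pn mf.
have -> : p \o f = (p \o @of_coords R E) \o (@to_coords R E \o f).
  by apply/funext => x /=; rewrite to_coordsK.
apply: measurableT_comp.
  by apply: continuous_measurable_rV; exact: continuous_norm_of_coords.
apply: measurable_fun_rV => i; rewrite -(splitK i).
case: (fintype.split i) => j /=; have [mr mi] := mf j.
  rewrite (_ : (fun t => _) = re_coord f j)//.
  by apply/funext => x; rewrite row_mxEl mxE.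
rewrite (_ : (fun t => _) = im_coord f j)//.
by apply/funext => x; rewrite row_mxEr mxE.
Qed.

(** Expanding g x in the real basis gives products of a coordinate of g x with phi (K x e), e a
    fixed vector; and A |-> phi (A e) is a real functional on the space of operators. *)
Lemma vmeasurable_app (F V : vectType R[i]) (K : T -> 'Hom(F, V)) (g : T -> F) :
  vmeasurable K -> vmeasurable g -> vmeasurable (fun x => K x (g x)).
Proof.
move=> mK mg.
have key (phi : V -> R) : real_functional phi ->
    measurable_fun setT (fun x => phi (K x (g x))).
  move=> phil.
  have Kl x : real_functional (fun v => phi (K x v)).
    exact: (real_functional_comp (real_linear_hom (K x)) phil).
  have ev (v : F) : real_functional (fun A : 'Hom(F, V) => phi (A v)).
    by split=> [A B|t A]; rewrite ?add_lfunE ?scale_lfunE ?phil.1 ?phil.2.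
  rewrite (_ : (fun _ => _) = fun x => \sum_j (rcoord j (g x) * phi (K x (vbasis {:F})`_j) +
      icoord j (g x) * phi (K x ('i%C *: (vbasis {:F})`_j)))); last first.
    by apply/funext => x; rewrite (real_functionalE (g x) (Kl x)).
  apply: measurable_sum => j; have [mr mi] := mg j.
  apply: measurable_funD; apply: measurable_funM => //.
    exact: (measurable_functional (ev _)).
  exact: (measurable_functional (ev _)).
move=> j; split.
  exact: (key _ (rcoord_functional j)).
exact: (key _ (icoord_functional j)).
Qed.

End measurability.

(** * Operator norms *)

Section op_norm.
Context (R : realType) (F V : vectType R[i]) (nF : F -> R) (nV : V -> R).
Hypotheses (hnF : is_norm nF) (hnV : is_norm nV).

Lemma norm_ge0 (E : vectType R[i]) (p : E -> R) v : is_norm p -> 0 <= p v.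
Proof. by case=> _ pD pZ; exact: seminorm_ge0. Qed.

Lemma norm0 (E : vectType R[i]) (p : E -> R) : is_norm p -> p 0 = 0.
Proof. by case=> _ pD pZ; exact: seminorm0. Qed.

Lemma norm_app_le_coord_norm (A : 'Hom(F, V)) :
  exists2 M, 0 < M & forall v, nV (A v) <= M * coord_norm v.
Proof.
case: hnV => _ nVD nVZ.
apply: (@seminorm_le_coord_norm _ _ (nV \o A)) => [x y|c x] /=.
  by rewrite linearD nVD.
by rewrite linearZ nVZ.
Qed.

(** [sup] takes a default value on unbounded sets, so [op_norm] is meaningful only because the unit
    ball of [nF] is bounded in coordinates. *)
Lemma has_sup_op_norm (A : 'Hom(F, V)) :
  has_sup [set nV (A v) | v in [set v | nF v <= 1]].
Proof.
split; first by exists (nV (A 0)); exists 0 => //=; rewrite (norm0 hnF).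
have [M M0 AM] := norm_app_le_coord_norm A.
have [M' M'0 FM] := coord_norm_le_norm hnF.
exists (M * M') => _ [v /= v1 <-]; rewrite (le_trans (AM v))// ler_pM2l//.
by rewrite (le_trans (FM v))// -[leRHS]mulr1 ler_pM2l.
Qed.

Lemma op_norm_ge0 (A : 'Hom(F, V)) : 0 <= op_norm nF nV A.
Proof.
rewrite (le_trans (norm_ge0 (A 0) hnV))//.
apply: (ub_le_sup (has_sup_op_norm A).2).
by exists 0 => //=; rewrite (norm0 hnF).
Qed.

Lemma op_norm_app (A : 'Hom(F, V)) v : nV (A v) <= op_norm nF nV A * nF v.
Proof.
have [v0|v0] := eqVneq (nF v) 0.
  have -> : v = 0 by case: hnF => + _ _; exact.
  by rewrite linear0 (norm0 hnV) (norm0 hnF) mulr0.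
have vp : 0 < nF v by rewrite lt_neqAle eq_sym v0 norm_ge0.
have [_ _ nFZ] := hnF; have [_ _ nVZ] := hnV.
rewrite -ler_pdivrMr// mulrC.
apply: (ub_le_sup (has_sup_op_norm A).2).
exists (((nF v)^-1)%:C%C *: v) => /=.
  by rewrite (seminormZr nFZ) normfV ger0_norm ?mulVf// ltW.
by rewrite linearZ (seminormZr nVZ) normfV ger0_norm// ltW.
Qed.

End op_norm.

(** * The Euclidean norm on row vectors *)

Section euclidean_norm.
Context (R : realType) (N : nat).
Implicit Types x y : 'rV[R]_N.

Lemma enorm_ge0 x : 0 <= enorm x.
Proof. exact: sqrtr_ge0. Qed.

Lemma coord_le_enorm x i : `|x ord0 i| <= enorm x.
Proof.
rewrite -sqrtr_sqr ler_wsqrtr// (bigD1 i)//= lerDl sumr_ge0// => j _.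
exact: sqr_ge0.
Qed.

Lemma enorm_le_sum x : enorm x <= \sum_i `|x ord0 i|.
Proof.
have S0 : 0 <= \sum_i `|x ord0 i| by exact: sumr_ge0.
rewrite -[leRHS]ger0_norm// -sqrtr_sqr ler_wsqrtr//.
rewrite expr2 mulr_suml ler_sum// => i _.
rewrite -real_normK ?num_real// expr2 ler_wpM2l//.
by rewrite (bigD1 i)//= lerDl sumr_ge0.
Qed.

Lemma enorm0 : enorm (0 : 'rV[R]_N) = 0.
Proof. by rewrite /enorm big1 ?sqrtr0// => i _; rewrite mxE expr0n. Qed.

Lemma enorm_gt0 x : x != 0 -> 0 < enorm x.
Proof.
move=> x0; rewrite lt_neqAle enorm_ge0 andbT eq_sym; apply: contra x0 => /eqP xe.
apply/eqP/rowP => i; rewrite mxE; apply/eqP; rewrite -normr_le0 -xe.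
exact: coord_le_enorm.
Qed.

Lemma enormZ (t : R) x : enorm (t *: x) = `|t| * enorm x.
Proof.
rewrite /enorm -sqrtr_sqr -sqrtrM ?sqr_ge0// mulr_sumr; congr Num.sqrt.
by apply: eq_bigr => i _; rewrite mxE exprMn.
Qed.

Lemma measurable_enorm : measurable_fun setT (@enorm R N).
Proof.
rewrite (_ : @enorm R N = (fun t => t `^ 2^-1) \o (fun x => \sum_i x ord0 i ^+ 2)).
  apply: measurableT_comp; first exact: measurable_powR.
  apply: measurable_sum => i; apply: measurable_funX; exact: measurable_coord_rV.
by apply/funext => x; rewrite /= powR12_sqrt// sumr_ge0// => i _; exact: sqr_ge0.
Qed.

Lemma measurable_sub_rV d (T : measurableType d) (f g : T -> 'rV[R]_N) :
  measurable_fun setT f -> measurable_fun setT g ->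
  measurable_fun setT (fun t => f t - g t).
Proof.
move=> mf mg; apply: measurable_fun_rV => i; under eq_fun do rewrite !mxE.
apply: measurable_funB.
  exact: (measurableT_comp (measurable_coord_rV i) mf).
exact: (measurableT_comp (measurable_coord_rV i) mg).
Qed.

(** A point is a box with a side of length 0; in dimension 0 there is no side and the measure is a
    Dirac mass. *)
Lemma lebesgue_rV_set1 x : (0 < N)%N -> lebesgue_rV R N [set x] = 0%E.
Proof.
move=> N0; rewrite (_ : [set x] = [set y | forall i, [set x ord0 i] (y ord0 i)]).
  have := @lebesgue_rV_box R N (fun i => [set x ord0 i]).
  move=> ->; last by move=> i; exact: measurable_set1.
  by rewrite (bigD1 (Ordinal N0))//= lebesgue_measure_set1 mul0e.
apply/seteqP; split=> [y /= -> //|y /= yx].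
by apply/rowP => i; exact: yx.
Qed.

Lemma measurable_rV_set1 x : measurable [set x].
Proof.
rewrite (_ : [set x] = \bigcap_(i in [set: 'I_N]) ((fun y : 'rV[R]_N => y ord0 i) @^-1` [set x ord0 i])).
  apply: fin_bigcap_measurable => // i _.
  by rewrite -[X in measurable X]setTI; exact: measurable_coord_rV.
apply/seteqP; split=> [y /= -> //|y /= yx].
by apply/rowP => i; exact: yx.
Qed.

End euclidean_norm.

(** * Smooth cutoffs on the line *)

Section cutoff.
Variable R : realType.

(** The difference quotient is at most M |z - x|. This yields the derivative of the bump at the
    points outside (-c, c), endpoints included. *)
Lemma is_derive_quadratic (f : R -> R) (x M : R) :
  (forall z, `|f z| <= M * (z - x) ^+ 2) -> is_derive x (1 : R) f 0.
Proof.
move=> fM; have fx : f x = 0.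
  by apply/eqP; rewrite -normr_le0 (le_trans (fM x))// subrr expr0n mulr0.
(* Division by zero yields 0, so the quotient already has the value of the derivative at z = x. *)
apply/is_derive1_caratheodory; exists (fun z => f z / (z - x)); split => [z||].
- have [->|zx] := eqVneq z x; first by rewrite !subrr mulr0.
  by rewrite fx subr0 divfK// subr_eq0.
- apply/cvgrPdist_le => e e0; rewrite subrr invr0 mulr0.
  near=> z; rewrite sub0r normrN normrM normfV.
  have [->|zx] := eqVneq z x; first by rewrite subrr normr0 invr0 mulr0 ltW.
  have zx0 : 0 < `|z - x| by rewrite normr_gt0 subr_eq0.
  rewrite ler_pdivrMr// (le_trans (fM z))//.
  apply: (@le_trans _ _ ((`|M| + 1) * (z - x) ^+ 2)).
    by rewrite ler_wpM2r ?sqr_ge0// (le_trans (ler_norm M))// lerDl.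
  rewrite -real_normK ?num_real// expr2 mulrA ler_pM2r// mulrC -ler_pdivlMr//.
    near: z; apply: (@cvgr_distC_le _ _ _ (nbhs x) _ id x) => //.
    by rewrite divr_gt0// ltr_wpDl.
- by rewrite subrr invr0 mulr0.
Unshelve. all: by end_near. Qed.

(** Raise v <= exp v, for v = u / (n + 1), to the power n + 1. With u = 1/s this lets exp (-1/s)
    absorb negative powers of s. *)
Lemma expR_ge_exprn (n : nat) (u : R) : 0 <= u -> (u / n.+1%:R) ^+ n.+1 <= expR u.
Proof.
move=> u0; rewrite [in leRHS](_ : u = u / n.+1%:R * n.+1%:R); last first.
  by rewrite divfK// pnatr_eq0.
rewrite expRM_natr lerXn2r// ?nnegrE ?expR_ge0 ?divr_ge0//.
by rewrite (le_trans _ (expR_ge1Dx _))// lerDr.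
Qed.

Variables (c : R) (c0 : 0 < c).

(** For p = 1 and m = 0 this is the classical mollifier on (-c, c); the factor p / (c^2 - t^2)^m
    accounts for the terms that differentiation produces. *)
Definition bump (p : {poly R}) (m : nat) (t : R) : R :=
  if `|t| < c then p.[t] / (c ^+ 2 - t ^+ 2) ^+ m * expR (- (c ^+ 2 - t ^+ 2)^-1)
  else 0.

(* [bump p m] differentiates to [bump (dbump p m) m.+2]: this family is closed
   under derivation. *)
Definition dbump (p : {poly R}) (m : nat) : {poly R} :=
  let s := (c ^+ 2)%:P - 'X ^+ 2 in
  p^`() * s ^+ 2 + (m.*2)%:R *: ('X * p * s) - 2%:R *: ('X * p).

Lemma bump_support p m t : c <= `|t| -> bump p m t = 0.
Proof. by rewrite /bump leNgt; case: ifP. Qed.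

Lemma horner_bounded (p : {poly R}) : exists M, forall t, `|t| <= c -> `|p.[t]| <= M.
Proof.
elim/poly_ind: p => [|p a [M Mp]].
  by exists 0 => t _; rewrite horner0 normr0.
exists (M * c + `|a|) => t tc; rewrite !hornerE.
by rewrite (le_trans (ler_normD _ _))// lerD// normrM ler_pM// Mp.
Qed.

(** With s = c^2 - t^2, the bound exp (-1/s) <= ((m + 2) s)^(m + 2) leaves s^2 after division by
    s^m, and s <= x^2 - t^2 <= 2 |x| |t - x| because c <= |x|. *)
Lemma bump_quadratic p m : exists M, forall x t, c <= `|x| ->
  `|bump p m t| <= M * x ^+ 2 * (t - x) ^+ 2.
Proof.
have [M0 Mp] := horner_bounded p.
pose M := `|M0|; have M_ge0 : 0 <= M by exact: normr_ge0.
exists (M * m.+2%:R ^+ m.+2 * 4) => x t cx.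
rewrite /bump; case: ifPn => [tc|_]; last first.
  by rewrite normr0 mulr_ge0 ?sqr_ge0// mulr_ge0 ?sqr_ge0// mulr_ge0// mulr_ge0// exprn_ge0.
set s := _ - _; have s0 : 0 < s.
  by rewrite /s subr_gt0 -(real_normK (num_real t)) ltrXn2r// ?nnegrE// ltW.
have e1 : expR (- s^-1) <= m.+2%:R ^+ m.+2 * s ^+ m.+2.
  have K0 : 0 < m.+2%:R ^+ m.+2 * s ^+ m.+2 :> R.
    by rewrite -exprMn exprn_gt0// mulr_gt0.
  rewrite expRN -[leRHS]invrK lef_pV2 ?posrE ?expR_gt0 ?invr_gt0//.
  have := @expR_ge_exprn m.+1 s^-1; rewrite invr_ge0 (ltW s0) => /(_ isT).
  by apply: le_trans; rewrite -exprMn -exprVn invfM mulrC.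
have s2 : s <= 2 * `|x| * `|t - x|.
  have : s <= `|x| ^+ 2 - `|t| ^+ 2.
    by rewrite /s -(real_normK (num_real t)) lerB// lerXn2r// ?nnegrE// ltW.
  move/le_trans; apply; rewrite subr_sqr mulrC ler_pM//.
  - by rewrite subr_ge0 ltW// (lt_le_trans tc).
  - by rewrite mulr2n mulrDl mul1r lerD2l ltW// (lt_le_trans tc).
  - by rewrite distrC; exact: lerB_dist.
rewrite !normrM normfV (ger0_norm (expR_ge0 _)) [`|s ^+ m|]ger0_norm ?exprn_ge0 ?(ltW s0)//.
apply: (@le_trans _ _ (M * (m.+2%:R ^+ m.+2 * s ^+ 2))).
  rewrite -mulrA; apply: ler_pM => //.
  - by rewrite mulr_ge0// ?expR_ge0// invr_ge0 exprn_ge0// ltW.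
  - by rewrite (le_trans (Mp _ (ltW tc)))// ler_norm.
  - rewrite mulrC ler_pdivrMr ?exprn_gt0// (le_trans e1)//.
    by rewrite (_ : s ^+ m.+2 = s ^+ 2 * s ^+ m) ?mulrA// -exprD.
have s22 : s ^+ 2 <= (2 * `|x| * `|t - x|) ^+ 2.
  by rewrite lerXn2r// nnegrE ?mulr_ge0// ltW.
have K0 : 0 <= m.+2%:R ^+ m.+2 :> R by exact: exprn_ge0.
move: K0; set K := _ ^+ m.+2 => K0.
rewrite (_ : M * K * 4 * x ^+ 2 * (t - x) ^+ 2 = M * (K * (2 * `|x| * `|t - x|) ^+ 2)).
  by rewrite ler_wpM2l// ler_wpM2l.
by rewrite !exprMn !real_normK ?num_real//; ring.
Qed.

Lemma is_derive_bump p m t : is_derive t (1 : R) (bump p m) (bump (dbump p m) m.+2 t).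
Proof.
have [tc|tc] := ltP `|t| c; last first.
  (* Here the bump and its claimed derivative both vanish, at the endpoints |t| = c as well. *)
  have [M Mb] := bump_quadratic p m.
  rewrite bump_support//.
  by apply: (@is_derive_quadratic _ _ (M * t ^+ 2)) => z; exact: Mb.
pose s (x : R) := c ^+ 2 - x ^+ 2.
have s0 : s t != 0.
  by rewrite gt_eqF// /s subr_gt0 -(real_normK (num_real t)) ltrXn2r// ?nnegrE// ltW.
apply: (@near_eq_is_derive _ _ _
   (horner p * (fun x => (s x)^-1) ^+ m * (expR \o (- (fun x => (s x)^-1))))).
  have : \forall x \near t, `|x| < c.
    exact: (@cvgr_norm_lt _ _ _ (nbhs t) _ id t cvg_id c tc).
  by apply: filterS => x xc; rewrite /bump xc /= !fctE exprVn.
have Ds : is_derive t (1 : R) s (- (2 * t)).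
  have := is_deriveB (is_derive_cst (c ^+ 2) t 1) (is_deriveX 2 (is_derive_id t (1 : R))).
  move=> H; apply: (is_derive_eq H).
  by rewrite sub0r expr1 -[_ *: _]/(_ * _) mulr1.
have Dinv := is_deriveV s0 Ds.
set u := fun x => (s x)^-1 in Dinv *.
have Du := is_deriveN Dinv.
have DE := is_derive1_comp (is_derive_expR ((- u) t)) Du.
have DX := @is_deriveX _ _ u m _ _ _ Dinv.
have D1 := is_deriveM (is_derive_poly p t) DX.
have D2 := is_deriveM D1 DE.
apply: (is_derive_eq D2) => {D2 D1 DX DE Du Dinv Ds}.
rewrite /bump tc /= -[c ^+ 2 - t ^+ 2]/(s t) /dbump.
rewrite !hornerE -/(s t) !fctE /u.
rewrite -![_ *: _]/(_ * _).
move: (expR _) => E.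
rewrite /= -mul2n natrM -!exprVn; move: s0; move: (s t) => x x0.
case: m => [|m]; first by rewrite !expr0; field.
have -> : x^-1 ^+ m.+3 = x^-1 ^+ m * x^-1 ^+ 3 by rewrite -exprD addn3.
by rewrite [x^-1 ^+ m.+1]exprS /=; move: (x^-1 ^+ m) => y; rewrite -addn1 natrD; field.
Qed.

Fixpoint bump_iter (n : nat) : {poly R} :=
  if n is n'.+1 then dbump (bump_iter n') n'.*2 else 1.

(** The n-th derivative of the mollifier normalised to be 1 at 0; each differentiation raises the
    power of the denominator by 2, whence [n.*2]. *)
Definition cutoff (n : nat) (t : R) : R := bump (bump_iter n) n.*2 t / bump 1 0 0.

Lemma cutoff_support n t : c <= `|t| -> cutoff n t = 0.
Proof. by move=> ct; rewrite /cutoff bump_support// mul0r. Qed.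

Lemma cutoff0 : cutoff 0 0 = 1.
Proof.
rewrite /cutoff divff// /bump normr0 c0 hornerE expr0 divr1 mul1r.
by rewrite gt_eqF// expR_gt0.
Qed.

Lemma is_derive_cutoff n t : is_derive t (1 : R) (cutoff n) (cutoff n.+1 t).
Proof.
have H := is_deriveM (is_derive_bump (bump_iter n) n.*2 t)
  (is_derive_cst (bump 1 0 0)^-1 t (1 : R)).
by apply: (is_derive_eq H); rewrite scaler0 add0r -[_ *: _]/(_ * _) mulrC.
Qed.

(* [cutoff_mon a b] is the [b]-th derivative of [t ^ a * cutoff 0 t], by Leibniz'
   rule for the product of [t] with [t ^ a.-1 * cutoff 0 t]. *)
Fixpoint cutoff_mon (a b : nat) (t : R) : R :=
  if a is a'.+1 then t * cutoff_mon a' b t + b%:R * cutoff_mon a' b.-1 t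
  else cutoff b t.

Lemma cutoff_mon_support a b t : c <= `|t| -> cutoff_mon a b t = 0.
Proof.
move=> ct; elim: a b => [|a IH] b /=; first exact: cutoff_support.
by rewrite !IH !mulr0 addr0.
Qed.

Lemma is_derive_cutoff_mon a b t :
  is_derive t (1 : R) (cutoff_mon a b) (cutoff_mon a b.+1 t).
Proof.
elim: a b => [|a IH] b; first exact: is_derive_cutoff.
have H := is_deriveD (is_deriveM (is_derive_id t (1 : R)) (IH b))
  (is_deriveM (is_derive_cst (b%:R : R) t (1 : R)) (IH b.-1)).
apply: (is_derive_eq H); rewrite scaler0 addr0 -![_ *: _]/(_ * _) /=.
case: b H => [|b] _ /=; first by ring.
by rewrite -[b.+2]addn1 natrD; ring.
Qed.

(** t^a times the cutoff vanishes to order a at 0 with leading coefficient 1. The restriction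
    [b <= a] keeps derivatives of the cutoff itself out of the value. *)
Lemma cutoff_mon_at0 a b : (b <= a)%N -> cutoff_mon a b 0 = (a`! * (a == b))%:R.
Proof.
elim: a b => [|a IH] [|b] //= ba; first by rewrite cutoff0.
  by rewrite !mul0r addr0 muln0.
rewrite mul0r add0r.
by rewrite IH// eqSS -natrM factS; case: eqP => [->|]; rewrite ?muln0// !muln1.
Qed.

Lemma cutoff_mon_bounded a b : exists M, forall t, `|cutoff_mon a b t| <= M.
Proof.
have [x _ xmax] : exists2 x, x \in `[- c, c]%R &
    forall t, t \in `[- c, c]%R -> `|cutoff_mon a b t| <= `|cutoff_mon a b x|.
  apply: (@EVT_max _ (fun t => `|cutoff_mon a b t|)).
    by rewrite (le_trans _ (ltW c0))// oppr_le0 ltW.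
  apply: continuous_subspaceT => t; apply: continuous_comp; last exact: norm_continuous.
  apply: differentiable_continuous; apply/derivable1_diffP.
  by case: (is_derive_cutoff_mon a b t).
exists `|cutoff_mon a b x| => t; have [tc|ct] := lerP `|t| c.
  by apply: xmax; rewrite in_itv/= -ler_norml.
by rewrite cutoff_mon_support ?normr0// ltW.
Qed.

Lemma cutoff_mon_lipschitz a b : exists M, forall t,
  `|cutoff_mon a b t - cutoff_mon a b 0| <= M * `|t|.
Proof.
have [M Mb] := cutoff_mon_bounded a b.+1.
have cont x : {for x, continuous (cutoff_mon a b)}.
  apply: differentiable_continuous; apply/derivable1_diffP.
  by case: (is_derive_cutoff_mon a b x).
exists M => t; have [t0|t0] := leP 0 t.
  have [x _ ->] := @MVT_segment _ _ (cutoff_mon a b.+1) _ _ t0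
    (fun x _ => is_derive_cutoff_mon a b x) (continuous_subspaceT cont).
  by rewrite subr0 normrM ler_wpM2r.
have [x _] := @MVT_segment _ _ (cutoff_mon a b.+1) _ _ (ltW t0)
    (fun x _ => is_derive_cutoff_mon a b x) (continuous_subspaceT cont).
by rewrite distrC sub0r => ->; rewrite normrM normrN ler_wpM2r.
Qed.

End cutoff.

(** * Tensor product test functions *)

Section tensor.
Context (R : realType) (N : nat).
Implicit Types (U : 'I_N -> nat -> R -> R) (b : 'I_N -> nat) (x : 'rV[R]_N).

(** In use, [U i n] is the n-th derivative of the i-th factor, so [b] is a multi-index of
    derivatives and partial derivatives act by increasing [b]. *)
Definition tensor U b x : R := \prod_i U i (b i) (x ord0 i).

Variable U : 'I_N -> nat -> R -> R.
Hypothesis dU : forall i n t, is_derive t (1 : R) (U i n) (U i n.+1 t).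

Lemma is_derive_tensor b j x :
  is_derive x (delta_mx ord0 j : 'rV[R]_N) (tensor U b)
    (tensor U (fun i => b i + (i == j))%N x).
Proof.
pose c := \prod_(i | i != j) U i (b i) (x ord0 i).
(* Only the j-th factor varies along the j-th basis vector; the others come out as the constant
   [c]. *)
have quotE : (fun h : R => h^-1 *: ((tensor U b \o shift x) (h *: delta_mx ord0 j) - tensor U b x)) =
  (fun h : R => c * (h^-1 *: ((U j (b j) \o shift (x ord0 j)) (h *: 1) - U j (b j) (x ord0 j)))).
  apply/funext => h; rewrite /tensor /= (bigD1 j)//= [in X in _ - X](bigD1 j)//=.
  rewrite (eq_bigr (fun i => U i (b i) (x ord0 i))); last first.
    by move=> i ij; rewrite !mxE (negbTE ij) mulr0 add0r.
  rewrite !mxE !eqxx/= -/c -mulrBl -![_ *: _]/(_ * _) !mulr1.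
  by rewrite mulrA mulrC.
have [du valu] := dU j (b j) (x ord0 j).
have cvgq : (fun h : R => h^-1 *: ((tensor U b \o shift x) (h *: delta_mx ord0 j) - tensor U b x)) @ 0^'
    --> tensor U (fun i => b i + (i == j))%N x.
  rewrite quotE [tensor _ _ _](_ : _ = c * U j (b j).+1 (x ord0 j)).
    by apply: cvgMr; rewrite -valu; exact: du.
  rewrite /tensor (bigD1 j)//= eqxx addn1 mulrC; congr (_ * _).
  by apply: eq_bigr => i ij; rewrite (negbTE ij) addn0.
split; first by apply/cvg_ex; eexists; exact: cvgq.
exact: cvg_lim cvgq.
Qed.

Lemma partial_tensor b j :
  partial j (tensor U b) = tensor U (fun i => b i + (i == j))%N.
Proof. by apply/funext => x; case: (is_derive_tensor b j x). Qed.

Lemma foldr_partial_tensor b s :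
  foldr (@partial R N) (tensor U b) s = tensor U (fun i => b i + count_mem i s)%N.
Proof.
elim: s => [|j s IH] /=.
  by congr tensor; apply/funext => i; rewrite addn0.
rewrite IH partial_tensor; congr tensor; apply/funext => i.
by rewrite -addnA [(_ + (i == j))%N]addnC eq_sym.
Qed.

Lemma mpartial_tensor k (alpha : multi_index N k) :
  mpartial alpha (tensor U (fun=> 0%N)) = tensor U (fun i => alpha i).
Proof.
have iterE n j b : iter n (partial j) (tensor U b) =
    tensor U (fun i => b i + n * (i == j))%N.
  elim: n => [|n IH] /=.
    by congr tensor; apply/funext => i; rewrite mul0n addn0.
  rewrite IH partial_tensor; congr tensor; apply/funext => i.
  by rewrite -addnA mulSn [((i == j) + _)%N]addnC.
rewrite /mpartial.
have foldE s : foldr (fun i psi => iter (alpha i) (partial i) psi)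
    (tensor U (fun=> 0%N)) s = tensor U (fun i => alpha i * count_mem i s)%N.
  elim: s => [|j s IH] /=.
    by congr tensor; apply/funext => i; rewrite muln0.
  rewrite IH iterE; congr tensor; apply/funext => i; rewrite mulnDr addnC eq_sym.
  by case: eqP => [->|]; rewrite ?muln0.
rewrite foldE; congr tensor; apply/funext => i.
by rewrite count_uniq_mem ?enum_uniq// mem_enum muln1.
Qed.

Lemma continuous_tensor b : continuous (tensor U b).
Proof.
have cU i n : continuous (U i n).
  move=> t; apply: differentiable_continuous; apply/derivable1_diffP.
  by case: (dU i n t).
suff H s : continuous (fun x : 'rV[R]_N => \prod_(i <- s) U i (b i) (x ord0 i)).
  exact: H.
elim: s => [|i s IH].
  rewrite (_ : (fun _ => _) = cst 1); first by exact: cst_continuous.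
  by apply/funext => x; rewrite big_nil.
rewrite (_ : (fun _ => _) = (fun x : 'rV[R]_N => U i (b i) (x ord0 i) *
    \prod_(i <- s) U i (b i) (x ord0 i))).
  move=> x; apply: (@continuousM _ 'rV[R]_N (fun x => U i (b i) (x ord0 i))).
    apply: (@continuous_comp 'rV[R]_N _ _ (fun x => x ord0 i) (U i (b i))).
      exact: coord_continuous.
    exact: cU.
  exact: IH.
by apply/funext => x; rewrite big_cons.
Qed.

Lemma test_function_tensor (rho : R) :
  (forall i t, rho <= `|t| -> U i 0 t = 0) -> test_function (tensor U (fun=> 0%N)).
Proof.
move=> U0; split.
  move=> s /=; rewrite foldr_partial_tensor; split; first exact: continuous_tensor.
  by move=> i x; case: (is_derive_tensor (fun i => 0 + count_mem i s)%N i x).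
pose A := [set x : 'rV[R]_N | forall i, `[- rho, rho]%classic (x ord0 i)].
have cA : compact A.
  by apply: (@rV_compact _ _ (fun=> `[- rho, rho]%classic)) => i; exact: segment_compact.
apply: (subclosed_compact _ cA); first exact: closed_closure.
have clA : closed A.
  rewrite (_ : A = \bigcap_(i in [set: 'I_N])
    ((fun x : 'rV[R]_N => x ord0 i) @^-1` `[- rho, rho]%classic)).
    apply: closed_bigI => i _.
    apply: (@closed_comp _ _ (fun x : 'rV[R]_N => x ord0 i)); last exact: interval_closed.
    by move=> x _; exact: coord_continuous.
  by apply/seteqP; split=> [x Ax i _|x Ax i]; exact: Ax.
rewrite [X in _ `<=` X](closure_id _).1//; apply: closureS => x /= tx i.
rewrite /= in_itv/= -ler_norml leNgt; apply: contra tx => /ltW xi.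
by rewrite /tensor (bigD1 i)//= U0// mul0r.
Qed.

End tensor.

Section tensor_lipschitz.
Context (R : realType) (N : nat) (f : 'I_N -> R -> R).
Hypothesis fb : forall i, exists M, forall t, `|f i t| <= M.
Hypothesis fl : forall i, exists M, forall t, `|f i t - f i 0| <= M * `|t|.

(** Induction on the list of factors. The bound and the Lipschitz estimate go together, since the
    latter for a longer product uses the former for the shorter one. *)
Lemma prod_lipschitz : exists2 M, 0 <= M & forall z : 'rV[R]_N,
  `|\prod_i f i (z ord0 i)| <= M /\
  `|\prod_i f i (z ord0 i) - \prod_i f i 0| <= M * \sum_i `|z ord0 i|.
Proof.
elim: (index_enum _) => [|i s [M M0 IH]].
  exists 1 => // z; rewrite !big_nil normr1 subrr normr0 mulr0.
  by split.
have [A Ab] := fb i; have [L Lb] := fl i.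
have A0 : 0 <= A by exact: le_trans (Ab 0).
have L0 : 0 <= L by have := Lb 1; rewrite normr1 mulr1; exact: le_trans.
exists (A * M + L * M + M) => [|z]; first by rewrite !addr_ge0// mulr_ge0.
have [IHb IHl] := IH z; rewrite !big_cons; split.
  rewrite normrM (@le_trans _ _ (A * M))// ?ler_pM//.
  by rewrite -addrA lerDl addr_ge0// mulr_ge0.
set S := \sum_(j <- s) _ in IHl *; have S0 : 0 <= S by exact: sumr_ge0.
set P := \prod_(j <- s) _ in IHb IHl *; set Q := \prod_(j <- s) _ in IHl *.
rewrite (_ : _ - _ = (f i (z ord0 i) - f i 0) * P + f i 0 * (P - Q)); last by ring.
rewrite (le_trans (ler_normD _ _))// !normrM.
apply: (@le_trans _ _ (L * `|z ord0 i| * M + A * (M * S))).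
  by apply: lerD; apply: ler_pM.
rewrite -subr_ge0 (_ : _ - _ = (A * M + M) * `|z ord0 i| + (L * M + M) * S); last by ring.
by rewrite addr_ge0// mulr_ge0// addr_ge0// mulr_ge0.
Qed.

End tensor_lipschitz.

Lemma vmeasurable_scale (R : realType) d (T : measurableType d) (E : vectType R[i])
    (h : T -> R) (f : T -> E) :
  measurable_fun setT h -> vmeasurable f ->
  vmeasurable (fun x => (h x)%:C%C *: f x).
Proof.
move=> mh mf j; have [mr mi] := mf j; split.
  rewrite (_ : re_coord _ _ = fun x => h x * re_coord f j x).
    exact: measurable_funM.
  by apply/funext => x; rewrite -(rcoord_functional j).2.
rewrite (_ : im_coord _ _ = fun x => h x * im_coord f j x).
  exact: measurable_funM.
by apply/funext => x; rewrite -(icoord_functional j).2.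
Qed.

Lemma coord_normZ (R : realType) (E : vectType R[i]) (t : R) (v : E) :
  coord_norm (t%:C%C *: v) = `|t| * coord_norm v.
Proof.
rewrite /coord_norm mulr_sumr; apply: eq_bigr => j _.
by rewrite (rcoord_functional j).2 (icoord_functional j).2 !normrM mulrDr.
Qed.

(** * Derivatives of cutoff monomials near the origin *)

Section cutoff_monomials.
Context (R : realType) (N k : nat).
Hypothesis N0 : (0 < N)%N.
Implicit Types (alpha beta : multi_index N k) (z : 'rV[R]_N).

(* If every coordinate of [z] is below [width], then [2 * enorm z <= 1]. *)
Definition width : R := (N%:R *+ 2)^-1.

Lemma width_gt0 : 0 < width.
Proof. by rewrite invr_gt0 -mulr_natr mulr_gt0// ltr0n. Qed.

Definition psi z : R := \prod_i cutoff_mon width 0 0 (z ord0 i).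

Definition dmono alpha beta z : R :=
  \prod_i cutoff_mon width (alpha i) (beta i) (z ord0 i).

Definition mfact alpha : nat := (\prod_i (alpha i)`!)%N.

Lemma mfact_gt0 alpha : (0 < mfact alpha)%N.
Proof. by apply: prodn_gt0 => i; exact: fact_gt0. Qed.

(** If alpha and beta differ but have the same degree, then beta_i < alpha_i for some i, and the
    i-th factor vanishes at 0; for beta = alpha the factors are the alpha_i!. *)
Lemma dmono_at0 alpha beta : mdegree alpha = mdegree beta ->
  \prod_i cutoff_mon width (alpha i) (beta i) 0 = (mfact alpha * (alpha == beta))%:R :> R.
Proof.
move=> ab; have [->|neq] := eqVneq alpha beta.
  rewrite muln1 /mfact natr_prod; apply: eq_bigr => i _.
  by rewrite cutoff_mon_at0 ?width_gt0// eqxx muln1.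
have [i ba] : exists i, (beta i < alpha i)%N.
  apply/existsP; apply: contraR neq => /existsPn le_ab.
  apply/eqP/ffunP => i; apply/val_inj/eqP => /=.
  have lei j : (alpha j <= beta j)%N by rewrite leqNgt.
  rewrite eqn_leq lei/= leqNgt; apply/negP => lti.
  have : (mdegree alpha < mdegree beta)%N.
    rewrite /mdegree (bigD1 i)//= [ltnRHS](bigD1 i)//= -addSn leq_add// leq_sum//.
  by rewrite ab ltnn.
rewrite muln0 (bigD1 i)//= cutoff_mon_at0 ?width_gt0 ?(ltnW ba)//.
by rewrite gtn_eqF// muln0 mul0r.
Qed.

Lemma psi_at0 : \prod_(i < N) cutoff_mon width 0 0 0 = 1 :> R.
Proof. by rewrite big1// => i _; rewrite cutoff_mon_at0 ?width_gt0. Qed.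

Lemma width_exceeded z : 1 < 2 * enorm z -> exists i, width <= `|z ord0 i|.
Proof.
move=> z1; apply/existsP; apply: contraTT z1 => /existsPn zw; rewrite -leNgt.
rewrite mulrC -ler_pdivlMr// mul1r (le_trans (enorm_le_sum _))//.
apply: (@le_trans _ _ (\sum_(i < N) width)).
  by apply: ler_sum => i _; rewrite ltW// ltNge.
rewrite sumr_const card_ord /width -[leLHS]mulr_natl -[(N%:R *+ 2)^-1]/((N%:R *+ 2)^-1) -[N%:R *+ 2]mulr_natl.
by rewrite invfM mulrCA divff ?mulr1// pnatr_eq0 -lt0n.
Qed.

Lemma dmono_support alpha beta z : 1 < 2 * enorm z -> dmono alpha beta z = 0.
Proof.
move=> /width_exceeded[i wi].
by rewrite /dmono (bigD1 i)//= cutoff_mon_support ?mul0r// ?width_gt0.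
Qed.

Lemma psi_support z : 1 < 2 * enorm z -> psi z = 0.
Proof.
move=> /width_exceeded[i wi].
by rewrite /psi (bigD1 i)// cutoff_mon_support ?width_gt0//; exact: mul0r.
Qed.

Lemma psi_lipschitz : exists2 M, 0 < M & forall z,
  `|psi z| <= M /\ `|1 - psi z| <= M * enorm z.
Proof.
have [|//|M M0 H] := @prod_lipschitz R N (fun=> cutoff_mon width 0 0).
- by move=> i; apply: cutoff_mon_bounded; exact: width_gt0.
- by move=> i; apply: cutoff_mon_lipschitz; exact: width_gt0.
exists (M * N%:R + M + 1) => [|z]; first by rewrite ltr_wpDl// addr_ge0// mulr_ge0.
have [Hb Hl] := H z; split.
  by rewrite (le_trans Hb)// -addrA addrCA lerDl addr_ge0// mulr_ge0.
rewrite distrC; move: Hl; rewrite psi_at0 => /le_trans; apply.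
apply: (@le_trans _ _ (M * (N%:R * enorm z))).
  rewrite ler_wpM2l// mulr_natl -[X in _ *+ X]card_ord -sumr_const ler_sum// => i _.
  exact: coord_le_enorm.
by rewrite mulrA ler_wpM2r ?enorm_ge0// -addrA lerDl addr_ge0.
Qed.

(* For |alpha| = |beta|, the part of the derivative [dmono alpha beta] of
   z^alpha psi(z) that vanishes at the origin. *)
Definition rest alpha beta z : R :=
  dmono alpha beta z - (mfact alpha * (alpha == beta))%:R * psi z.

Lemma rest_support alpha beta z : 1 < 2 * enorm z -> rest alpha beta z = 0.
Proof. by move=> z1; rewrite /rest dmono_support// psi_support// mulr0 subrr. Qed.

(** [rest] is [dmono] minus its value at 0, plus a multiple of 1 - psi; both parts vanish at 0 and
    are Lipschitz. *)
Lemma rest_le : exists2 M, 0 < M & forall alpha beta,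
  mdegree alpha = mdegree beta -> forall z, `|rest alpha beta z| <= M * enorm z.
Proof.
have [P P0 psiP] := psi_lipschitz.
have /choice[M HM] (ab : multi_index N k * multi_index N k) : exists M, 0 <= M /\
    forall z, `|dmono ab.1 ab.2 z - \prod_i cutoff_mon width (ab.1 i) (ab.2 i) 0| <= M * enorm z.
  have [|//|M M0 H] := @prod_lipschitz R N (fun i => cutoff_mon width (ab.1 i) (ab.2 i)).
  - by move=> i; apply: cutoff_mon_bounded; exact: width_gt0.
  - by move=> i; apply: cutoff_mon_lipschitz; exact: width_gt0.
  exists (M * N%:R); split; first by rewrite mulr_ge0.
  move=> z; apply: le_trans (H z).2 _; rewrite -mulrA ler_wpM2l//.
  rewrite mulr_natl -[X in _ *+ X]card_ord -sumr_const ler_sum// => i _.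
  exact: coord_le_enorm.
pose Q ab := M ab + (mfact ab.1)%:R * P.
have Q0 ab : 0 <= Q ab by rewrite addr_ge0 ?(HM ab).1// mulr_ge0// ltW.
(* There are finitely many pairs of multi-indices, so the sum of their constants serves them all. *)
exists (\sum_ab Q ab + 1) => [|alpha beta ab z]; first by rewrite ltr_wpDl// sumr_ge0.
apply: (@le_trans _ _ (Q (alpha, beta) * enorm z)); last first.
  rewrite ler_wpM2r ?enorm_ge0// (bigD1 (alpha, beta))//= -addrA lerDl.
  by rewrite addr_ge0// sumr_ge0.
rewrite /rest (_ : _ - _ = (dmono alpha beta z - (mfact alpha * (alpha == beta))%:R) +
   (mfact alpha * (alpha == beta))%:R * (1 - psi z)); last by ring.
rewrite (le_trans (ler_normD _ _))// /Q mulrDl lerD//.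
  by have := (HM (alpha, beta)).2 z; rewrite /= dmono_at0.
rewrite normrM ger0_norm// -mulrA ler_pM//; last exact: (psiP z).2.
by rewrite /= ler_nat -[leqRHS]muln1 leq_mul2l leq_b1 orbT.
Qed.

End cutoff_monomials.

(** * Integrability of compactly supported multiples of a locally integrable field *)

Section box.
Context (R : realType) (N : nat).

Definition box (r : R) : set 'rV[R]_N := [set x | forall i, `[- r, r]%classic (x ord0 i)].

Lemma compact_box r : compact (box r).
Proof.
by apply: (@rV_compact _ _ (fun=> `[- r, r]%classic)) => i; exact: segment_compact.
Qed.

Lemma measurable_box r : measurable (box r).
Proof.
rewrite (_ : box r = \bigcap_(i in [set: 'I_N])
    ((fun x : 'rV[R]_N => x ord0 i) @^-1` `[- r, r]%classic)).
  apply: fin_bigcap_measurable => // i _.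
  by rewrite -[X in measurable X]setTI; exact: measurable_coord_rV.
by apply/seteqP; split=> [x Ax i _|x Ax i]; exact: Ax.
Qed.

Lemma enorm_box r x : enorm x <= r -> box r x.
Proof.
by move=> xr i; rewrite /= in_itv/= -ler_norml (le_trans _ xr)// coord_le_enorm.
Qed.

Lemma vintegrable_local (E : vectType R[i]) (g : 'rV[R]_N -> E) (h : 'rV[R]_N -> R) M r :
  vlocally_integrable g -> measurable_fun setT h -> (forall y, `|h y| <= M) ->
  (forall y, r < enorm y -> h y = 0) ->
  vintegrable (lebesgue_rV R N) setT (fun y => (h y)%:C%C *: g y).
Proof.
move=> [mg lg] mh hM h0.
have ig := integrable_coord_norm (measurable_box r) (lg _ (compact_box (r := r))).
have M0 : 0 <= M by apply: le_trans (hM 0).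
apply: (@vintegrable_bounded _ _ _ _ _ _ _
   ((fun y => M%:E * (coord_norm (g y))%:E) \_ (box r))%E) => //.
- exact: vmeasurable_scale.
- apply/(integrable_mkcond _ (measurable_box r)).
  by apply: integrableZl => //; exact: measurable_box.
move=> y _; rewrite coord_normZ patchE; case: ifPn => [_|].
  by rewrite -EFinM lee_fin ler_wpM2r// coord_norm_ge0.
rewrite notin_setE => nby; rewrite h0 ?normr0 ?mul0r// ltNge.
by apply/negP => /enorm_box.
Qed.

End box.

(** * Cutoff monomials at scale r *)

Section scaled_monomials.
Context (R : realType) (N k : nat).
Hypothesis N0 : (0 < N)%N.
Implicit Types alpha beta : multi_index N k.
Variables (r : R) (r0 : 0 < r).

(** For n = 0 this is t^(alpha i) times the cutoff at t / r, so the tensor product is y^alpha psi (y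
    / r); dividing by r^n accounts for the chain rule in the n-th derivative. *)
Definition scaled_mono alpha (i : 'I_N) (n : nat) (t : R) : R :=
  r ^+ alpha i / r ^+ n * cutoff_mon (width R N) (alpha i) n (r^-1 * t).

Lemma is_derive_scaled_mono alpha i n t :
  is_derive t (1 : R) (scaled_mono alpha i n) (scaled_mono alpha i n.+1 t).
Proof.
have Ds : is_derive t (1 : R) (fun t => r^-1 * t) r^-1.
  have := is_deriveM (is_derive_cst (r^-1 : R) t (1 : R)) (is_derive_id t (1 : R)).
  move=> H; apply: (is_derive_eq H).
  by rewrite scaler0 addr0 -[_ *: _]/(_ * _) mulr1.
have Dc := @is_derive1_comp _ _ _ _ _ _ 
   (is_derive_cutoff_mon (width_gt0 R N0) (alpha i) n (r^-1 * t)) Ds.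
have D := is_deriveM (is_derive_cst (r ^+ alpha i / r ^+ n : R) t (1 : R)) Dc.
apply: (is_derive_eq D); rewrite scaler0 addr0 -[_ *: _]/(_ * _) /scaled_mono.
by rewrite exprS /cst; field; rewrite ?expf_neq0 gt_eqF.
Qed.

Lemma test_function_scaled_mono alpha :
  test_function (tensor (scaled_mono alpha) (fun=> 0%N)).
Proof.
apply: (@test_function_tensor _ _ _ (is_derive_scaled_mono alpha) (r * width R N)) => i t rt.
rewrite /scaled_mono cutoff_mon_support ?mulr0// normrM gtr0_norm ?invr_gt0//.
by rewrite ler_pdivlMl.
Qed.

(** The powers of r cancel because both multi-indices have the same degree; this is where
    homogeneity of the operator makes the moment estimate uniform in the scale. *)
Lemma mpartial_scaled_mono alpha beta y : mdegree alpha = mdegree beta ->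
  mpartial beta (tensor (scaled_mono alpha) (fun=> 0%N)) y =
  dmono alpha beta (r^-1 *: y).
Proof.
move=> ab; rewrite (mpartial_tensor (is_derive_scaled_mono alpha)) /tensor.
rewrite /scaled_mono big_split /= (_ : \prod_i (r ^+ alpha i / r ^+ beta i) = 1).
  by rewrite mul1r; apply: eq_bigr => i _; rewrite !mxE.
by rewrite prodf_div !prodrXr -/(mdegree alpha) ab divff// expf_neq0// gt_eqF.
Qed.

Lemma measurable_cutoff_mon_prod (a c : 'I_N -> nat) :
  measurable_fun setT (fun y : 'rV[R]_N =>
    \prod_i cutoff_mon (width R N) (a i) (c i) ((r^-1 *: y) ord0 i)).
Proof.
apply: measurable_prod => i _.
apply: (@measurableT_comp _ _ _ _ _ _ (cutoff_mon (width R N) (a i) (c i))).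
  apply: continuous_measurable_fun => t.
  apply: differentiable_continuous; apply/derivable1_diffP.
  by case: (is_derive_cutoff_mon (width_gt0 R N0) (a i) (c i) t).
under eq_fun do rewrite mxE.
by apply: measurable_funM => //; exact: measurable_coord_rV.
Qed.

End scaled_monomials.

(** * The moment estimate for fields in the kernel of a cocanceling operator *)

Section moment.
Context (R : realType) (N k : nat) (F V : vectType R[i]) (nV : V -> R).
Hypotheses (N0 : (0 < N)%N) (hnV : is_norm nV).
Variable b : multi_index N k -> 'Hom(F, V).
Hypothesis hb : cocanceling b.
Local Notation mu := (lebesgue_rV R N).

Definition coef_norm (v : F) : R := \sum_(alpha | mdegree alpha == k) nV (b alpha v).

(* A vector killed by every coefficient is killed by every [symbol b xi]. *)
Lemma coef_norm_is_norm : is_norm coef_norm.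
Proof.
have [nV0 nVD nVZ] := hnV; split.
- move=> v /psumr_eq0P => v0.
  have bv alpha : mdegree alpha == k -> b alpha v = 0.
    by move=> ak; apply/nV0/v0 => // i _; exact: norm_ge0.
  have : [set 0] v; last by [].
  rewrite -hb => xi xi0 /=; rewrite memv_ker /symbol sum_lfunE big1// => alpha ak.
  by rewrite scale_lfunE bv// scaler0.
- move=> u v; rewrite /coef_norm -big_split/=; apply: ler_sum => alpha _.
  by rewrite linearD nVD.
- move=> c v; rewrite /coef_norm mulr_sumr; apply: eq_bigr => alpha _.
  by rewrite linearZ nVZ.
Qed.

(** The weight |y| / r on the right is the one that [kern] asks for: with r = |x|, multiplying it by
    |x|^(l-N) gives |y| |x|^(l-N-1). *)
Lemma moment_estimate : exists2 M, 0 < M & forall g, distributional_kernel b g ->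
  forall r, 0 < r ->
  ((coord_norm (vintegral mu (fun y => (psi (r^-1 *: y))%:C%C *: g y)))%:E <=
   M%:E * \int[mu]_(y in [set y | (2 * enorm y <= r)%R]) (r^-1 * enorm y * coord_norm (g y))%:E)%E.
Proof.
have [nV0 nVD nVZ] := hnV.
have [A A0 FA] := coord_norm_le_norm coef_norm_is_norm.
have [B B0 restB] := rest_le R k N0.
have [P P0 psiP] := psi_lipschitz R N0.
have /choice[D HD] (beta : multi_index N k) : exists D, 0 < D /\
    forall v, nV (b beta v) <= D * coord_norm v.
  by have [D D0 bD] := norm_app_le_coord_norm hnV (b beta); exists D.
(* Up to the integral [I], the inner sum bounds nV (b alpha v) for v the moment of psi, as in [bG];
   the outer sum then bounds [coef_norm v]. *)
pose S := \sum_(alpha | @mdegree N k alpha == k) \sum_(beta | @mdegree N k beta == k) D beta * B.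
have S0 : 0 <= S.
  by apply: sumr_ge0 => alpha _; apply: sumr_ge0 => beta _; rewrite mulr_ge0 ?ltW ?(HD beta).1.
exists (A * S + 1) => [|g [lg kg] r r0]; first by rewrite ltr_wpDl// mulr_ge0// ltW.
set Y := [set y | _]; set I := (\int[mu]_(y in Y) _)%E.
pose G h := vintegral mu (fun y => (h (r^-1 *: y))%:C%C *: g y).
have scale_enorm y : enorm (r^-1 *: y) = r^-1 * enorm y.
  by rewrite enormZ gtr0_norm ?invr_gt0.
have big_scale y : r < 2 * enorm y -> 1 < 2 * enorm (r^-1 *: y).
  by move=> ry; rewrite scale_enorm mulrCA -ltr_pdivrMl ?invr_gt0// invrK mulr1.
have mY : measurable Y.
  rewrite (_ : Y = (@enorm R N) @^-1` `]-oo, (r / 2)]%classic).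
    by rewrite -[X in measurable X]setTI; apply: measurable_enorm.
  by apply/seteqP; split=> y; rewrite /Y /= in_itv/= ler_pdivlMr// mulrC.
have Ybox : Y `<=` box r.
  move=> y /= yr; apply: enorm_box; rewrite (le_trans _ yr)//.
  by rewrite mulr2n mulrDl mul1r lerDl enorm_ge0.
have ig : mu.-integrable Y (fun y => (r^-1 * enorm y * coord_norm (g y))%:E).
  have igbox := integrable_coord_norm (measurable_box r) (lg.2 _ (compact_box (r := r))).
  apply: (le_integrable mY _ _ (integrableS (measurable_box r) mY Ybox igbox)).
    apply/measurable_EFinP; apply: measurable_funTS; apply: measurable_funM.
      by apply: measurable_funM => //; exact: measurable_enorm.
    exact: (measurable_coord_norm lg.1).
  move=> y Yy; rewrite lee_fin normrM ler_piMl//.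
  rewrite ger0_norm ?mulr_ge0 ?enorm_ge0 ?invr_ge0 ?(ltW r0)//.
  rewrite ler_pdivrMl// mulr1 (le_trans _ Yy)//.
  by rewrite mulr2n mulrDl mul1r lerDl enorm_ge0.
have I0 : (0 <= I)%E.
  apply: integral_ge0 => y _.
  by rewrite lee_fin mulr_ge0 ?coord_norm_ge0// mulr_ge0 ?enorm_ge0// invr_ge0 ltW.
have Ifin : I \is a fin_num by exact: integrable_fin_num.
have mpsi : measurable_fun setT (fun y : 'rV[R]_N => psi (r^-1 *: y)).
  exact: (measurable_cutoff_mon_prod N0 r (fun=> 0%N) (fun=> 0%N)).
have mrest alpha beta : measurable_fun setT
    (fun y : 'rV[R]_N => @rest R N k alpha beta (r^-1 *: y)).
  apply: measurable_funB; last by apply: measurable_funM.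
  exact: (measurable_cutoff_mon_prod N0 r (fun i => alpha i) (fun i => beta i)).
have outside y : r < enorm y -> 1 < 2 * enorm (r^-1 *: y :> 'rV[R]_N).
  move=> ry; apply: big_scale; rewrite (lt_le_trans ry)//.
  by rewrite mulr2n mulrDl mul1r lerDl enorm_ge0.
have ipsi : vintegrable mu setT (fun y => (psi (r^-1 *: y))%:C%C *: g y).
  apply: (@vintegrable_local _ _ _ _ _ P r) => // y; first exact: (psiP _).1.
  by move=> /outside/(psi_support N0).
have rest_bounded alpha beta (z : 'rV[R]_N) : mdegree alpha = mdegree beta ->
    `|@rest R N k alpha beta z| <= B.
  move=> ab; have [z1|z1] := leP (2 * enorm z) 1; last first.
    by rewrite rest_support// normr0 ltW.
  rewrite (le_trans (restB _ _ ab z))// -[leRHS]mulr1 ler_pM2l// (le_trans _ z1)//.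
  by rewrite mulr2n mulrDl mul1r lerDl enorm_ge0.
have irest alpha beta : mdegree alpha = mdegree beta -> vintegrable mu setT
    (fun y => (@rest R N k alpha beta (r^-1 *: y))%:C%C *: g y).
  move=> ab; apply: (@vintegrable_local _ _ _ _ _ B r) => // y.
    exact: rest_bounded.
  by move=> /outside/(rest_support N0).
have Grest alpha beta : mdegree alpha = mdegree beta ->
    coord_norm (G (@rest R N k alpha beta)) <= B * fine I.
  move=> ab; rewrite -lee_fin EFinM fineK//.
  rewrite (le_trans (coord_norm_vintegral (irest _ _ ab)))// /I.
  rewrite -(ge0_integralZl_EFin _ mY) ?(ltW B0)//; last 2 first.
  - move=> y _; rewrite lee_fin mulr_ge0 ?coord_norm_ge0// mulr_ge0 ?enorm_ge0//.
    by rewrite invr_ge0 ltW.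
  - by case/integrableP: ig.
  rewrite [leRHS]integral_mkcond; apply: ge0_le_integral => //.
  - by move=> y _; rewrite lee_fin coord_norm_ge0.
  - apply/measurable_EFinP/measurable_coord_norm/vmeasurable_scale => //.
    exact: lg.1.
  - apply/(measurable_restrictT _ mY); apply: measurable_funeM.
    by case/integrableP: ig.
  move=> y _; rewrite coord_normZ patchE; case: ifPn => [_|].
    rewrite -EFinM lee_fin mulrA ler_wpM2r ?coord_norm_ge0//.
    by rewrite -scale_enorm; exact: restB.
  rewrite notin_setE /Y /= => /negP; rewrite -ltNge => /big_scale/(rest_support N0) ->.
  by rewrite normr0 mul0r.
pose mf alpha beta : R := (@mfact N k alpha * (alpha == beta))%:R.
have dmonoE alpha beta : (fun y => (@dmono R N k alpha beta (r^-1 *: y))%:C%C *: g y) =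
    (fun y => (@rest R N k alpha beta (r^-1 *: y))%:C%C *: g y) \+
    ((fun v : F => (mf alpha beta)%:C%C *: v) \o (fun y => (psi (r^-1 *: y))%:C%C *: g y)).
  apply/funext => y /=; rewrite scalerA -scalerDl -rmorphM -rmorphD.
  by congr (_%:C%C *: _); rewrite /rest subrK.
have impsi alpha beta := vintegrable_linear
  (@real_linear_scale R F (mf alpha beta)) measurableT ipsi.
have idmono alpha beta : mdegree alpha = mdegree beta -> vintegrable mu setT
    (fun y => (@dmono R N k alpha beta (r^-1 *: y))%:C%C *: g y).
  by move=> ab; rewrite dmonoE; apply: vintegrableD => //; exact: irest.
have Gdmono alpha beta : mdegree alpha = mdegree beta ->
    G (@dmono R N k alpha beta) =
    G (@rest R N k alpha beta) + (mf alpha beta)%:C%C *: G (@psi R N).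
  move=> ab; rewrite /G dmonoE vintegralD//; last exact: irest.
  by rewrite (vintegral_linear (@real_linear_scale R F (mf alpha beta)))//.
(* The equation tested against the scaled monomial of exponent alpha, with [b beta] taken out of the
   integral and the common sign (-1)^k removed. *)
have kernelE alpha : mdegree alpha = k ->
    \sum_(beta | mdegree beta == k) b beta (G (@dmono R N k alpha beta)) = 0.
  move=> ak; have := kg _ (test_function_scaled_mono N0 r0 alpha).
  rewrite (eq_bigr (fun beta => (-1) ^+ k *: b beta (G (@dmono R N k alpha beta)))).
    rewrite -scaler_sumr => /eqP; rewrite scaler_eq0 signr_eq0/= => /eqP.
    exact.
  move=> beta /eqP bk; rewrite bk; congr (_ *: _).
  rewrite -(vintegral_linear (real_linear_hom (b beta))); last first.
    by apply: idmono; rewrite ak bk.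
  congr vintegral; apply/funext => y /=.
  by rewrite mpartial_scaled_mono ?ak ?bk// linearZ.
have bG alpha : mdegree alpha = k ->
    nV (b alpha (G (@psi R N))) <= \sum_(beta | @mdegree N k beta == k) D beta * B * fine I.
  move=> ak; have := kernelE _ ak.
  rewrite (eq_bigr (fun beta => b beta (G (@rest R N k alpha beta)) +
     (mf alpha beta)%:C%C *: b beta (G (@psi R N)))); last first.
    by move=> beta /eqP bk; rewrite Gdmono ?ak ?bk// linearD linearZ.
  (* Only beta = alpha retains the moment of psi, with the factor alpha!, so the equation expresses
     this term by the moments of [rest]. *)
  rewrite big_split/= [X in _ + X](bigD1 alpha) ?ak//= [X in _ + (_ + X)]big1; last first.
    by move=> beta /andP[_ ba]; rewrite /mf eq_sym (negbTE ba) muln0 scale0r.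
  rewrite addr0 /mf eqxx muln1 => /eqP; rewrite addr_eq0 => /eqP E.
  (* Since alpha! >= 1, inserting this factor does not decrease the norm. *)
  apply: (@le_trans _ _ (nV ((mfact alpha)%:R%:C%C *: b alpha (G (@psi R N))))).
    rewrite (seminormZr nVZ) ger0_norm// ler_peMl ?norm_ge0// ler1n.
    exact: mfact_gt0.
  rewrite -(seminormN nVZ) -E (le_trans (seminorm_sum nVD nVZ _ _ _))//.
  rewrite ler_sum// => beta /eqP bk; rewrite (le_trans ((HD beta).2 _))//.
  by rewrite -mulrA ler_pM2l ?(HD beta).1// Grest// ak bk.
rewrite -(fineK Ifin) -EFinM lee_fin (le_trans (FA _))//.
rewrite mulrDl mul1r (@le_trans _ _ (A * S * fine I))//; last first.
  by rewrite lerDl fine_ge0.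
rewrite -mulrA ler_pM2l// mulr_suml ler_sum// => alpha /eqP ak.
by rewrite mulr_suml; exact: bG.
Qed.
End moment.

(** * Minkowski's integral inequality *)

Section minkowski_integral.
Local Open Scope ereal_scope.
Context d1 d2 (X : measurableType d1) (Y : measurableType d2) (R : realType).
Variables (nu : {sigma_finite_measure set X -> \bar R})
          (mu : {sigma_finite_measure set Y -> \bar R}).
Variables (f : X * Y -> R) (q : R).
Hypotheses (mf : measurable_fun setT f) (f0 : forall z, (0 <= f z)%R).
Hypothesis q1 : (1 <= q)%R.

Let G x := \int[mu]_y (f (x, y))%:E.
Let N y := (\int[nu]_x ((f (x, y)) `^ q)%:E) `^ q^-1.

Let q0 : (0 < q)%R. Proof. exact: lt_le_trans q1. Qed.

Let G0 x : 0 <= G x.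
Proof. by apply: integral_ge0 => y _; rewrite lee_fin. Qed.

Let mG : measurable_fun setT G.
Proof.
apply: (measurable_fun_fubini_tonelli_F (EFin \o f)); first exact/measurable_EFinP.
by move=> z; rewrite lee_fin.
Qed.

Lemma measurable_section_norm :
  measurable_fun setT (fun y => (\int[nu]_x ((f (x, y)) `^ q)%:E) `^ q^-1).
Proof.
apply: (@measurableT_comp _ _ _ _ _ _ (fun x : \bar R => x `^ q^-1)) => //=; first exact: measurable_poweR.
have := @measurable_fun_fubini_tonelli_G _ _ _ _ _ nu (fun z => (f z `^ q)%:E).
apply; last by move=> z; rewrite lee_fin powR_ge0.
  apply/measurable_EFinP.
exact: (@measurableT_comp _ _ _ _ _ _ (@powR R ^~ q)).
Qed.

Let mN : measurable_fun setT N := measurable_section_norm.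

(* The finiteness of the integral of [h ^ q] is what allows the cancellation
   of one of its powers after Hoelder's inequality. *)
Let minkowski_below (h : X -> R) : measurable_fun setT h ->
  (forall x, (0 <= h x)%R) -> (forall x, (h x)%:E <= G x) ->
  \int[nu]_x (h x `^ q)%:E < +oo ->
  (\int[nu]_x (h x `^ q)%:E) `^ q^-1 <= \int[mu]_y N y.
Proof.
move=> mh h0 hG hoo; set A := \int[nu]_x _.
have A0 : 0 <= A by rewrite /A; apply: integral_ge0 => x _; rewrite lee_fin powR_ge0.
have N0 y : 0 <= N y by exact: poweR_ge0.
have mhq r : measurable_fun setT (fun x => h x `^ r)%R.
  exact: (@measurableT_comp _ _ _ _ _ _ (@powR R ^~ r)).
(* Write h^q = h^(q-1) h <= h^(q-1) G, exchange the integrals, and apply Hoelder in x with exponents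
   q/(q-1) and q. *)
have key : A <= A `^ (1 - q^-1) * \int[mu]_y N y.
  have AE : A = \int[nu]_x ((h x `^ (q - 1))%:E * (h x)%:E).
    apply: eq_integral => x _; rewrite -EFinM; congr EFin.
    have [hx0|hx0] := eqVneq (h x) 0%R.
      by rewrite hx0 mulr0 powR0// gt_eqF.
    rewrite -[X in (_ * X)%R]powRr1// -powRD ?subrK//.
    by apply/implyP.
  rewrite {1}AE.
  apply: (@le_trans _ _ (\int[nu]_x \int[mu]_y ((h x `^ (q - 1) * f (x, y))%:E))).
    apply: ge0_le_integral => //.
    - by move=> x _; rewrite -EFinM lee_fin mulr_ge0 ?powR_ge0.
    - by apply/measurable_EFinP; exact: measurable_funM.
    - apply: (measurable_fun_fubini_tonelli_F
        (fun z => (h z.1 `^ (q - 1) * f z)%:E)) => /=.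
        apply/measurable_EFinP; apply: measurable_funM => //.
        by apply: (measurableT_comp (mhq _)).
      by move=> z; rewrite lee_fin mulr_ge0 ?powR_ge0.
    - move=> x _; under eq_integral do rewrite EFinM.
      rewrite ge0_integralZl_EFin//.
      + by rewrite lee_wpmul2l// lee_fin powR_ge0.
      + by move=> y _; rewrite lee_fin.
      + apply/measurable_EFinP; apply: measurableT_comp => //.
      + by rewrite powR_ge0.
  rewrite (@fubini_tonelli _ _ _ _ _ nu mu
        (fun z => (h z.1 `^ (q - 1) * f z)%:E)); last 2 first.
  - apply/measurable_EFinP; apply: measurable_funM => //.
    by apply: (measurableT_comp (mhq _)).
  - by move=> z; rewrite lee_fin mulr_ge0 ?powR_ge0.
  rewrite -ge0_integralZl//; last exact: poweR_ge0.
  apply: ge0_le_integral => //.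
  - move=> y _; apply: integral_ge0 => x _.
    by rewrite lee_fin mulr_ge0 ?powR_ge0.
  - apply: (measurable_fun_fubini_tonelli_G
        (fun z => (h z.1 `^ (q - 1) * f z)%:E)) => /=.
        apply/measurable_EFinP; apply: measurable_funM => //.
        by apply: (measurableT_comp (mhq _)).
      by move=> z; rewrite lee_fin mulr_ge0 ?powR_ge0.
  - by apply: measurable_funeM.
  move=> y _ /=.
  have mfy : measurable_fun setT (fun x => f (x, y)) by apply: measurableT_comp.
  (* For q = 1 the conjugate exponent would be infinite, but h^(q-1) is then constantly 1. *)
  rewrite /N; have [qE|qn1] := eqVneq q 1%R.
    rewrite qE invr1 subrr poweRe0 mul1e poweRe1; last first.
      by apply: integral_ge0 => x _; rewrite lee_fin powR_ge0.
    rewrite [leLHS](_ : _ = \int[nu]_x (f (x, y) `^ 1)%:E)//.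
    by apply: eq_integral => x _; rewrite powRr0 mul1r powRr1.
  have q1' : (1 < q)%R by rewrite lt_neqAle eq_sym qn1.
  have := @hoelder _ _ _ nu (fun x => h x `^ (q - 1))%R (fun x => f (x, y))
     (q / (q - 1)) q (mhq _) mfy.
  rewrite divr_gt0 ?subr_gt0// => /(_ isT q0); rewrite invf_div.
  have -> : ((q - 1) / q + q^-1 = 1)%R by field; rewrite gt_eqF.
  move=> /(_ erefl); rewrite Lnorm1 unlock/=.
  rewrite invf_div.
  have -> : ((q - 1) / q = 1 - q^-1)%R by field; rewrite gt_eqF.
  rewrite [X in X <= _ -> _](_ : _ = \int[nu]_x (h x `^ (q - 1) * f (x, y))%:E); last first.
    by apply: eq_integral => x _; rewrite ger0_norm// mulr_ge0 ?powR_ge0.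
  rewrite [X in _ <= X `^ _ * _ -> _](_ : _ = A); last first.
    apply: eq_integral => x _; rewrite ger0_norm ?powR_ge0// -powRrM.
    by congr (_ `^ _)%:E; field; rewrite subr_eq0.
  rewrite [X in _ <= _ * X `^ _ -> _](_ : _ = \int[nu]_x (f (x, y) `^ q)%:E)//.
  by apply: eq_integral => x _; rewrite ger0_norm.
have [->|An0] := eqVneq A 0.
  by rewrite poweR0r ?invr_neq0 ?gt_eqF// integral_ge0.
have Af : A \is a fin_num by rewrite ge0_fin_numE.
have Agt0 : (0 < fine A)%R by rewrite fine_gt0// hoo lt0e An0 A0.
move: key; rewrite -(fineK Af) !poweR_EFin => key.
rewrite -(@lee_pmul2l _ ((fine A) `^ (1 - q^-1))%:E) ?lte_fin ?powR_gt0//.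
  rewrite -EFinM -powRD ?subrK ?powRr1 ?(ltW Agt0)//.
  by apply/implyP => _; rewrite gt_eqF.
Qed.


(** Cut at height n and restricted to a set that will have finite measure, so that the q-th power is
    integrable even where [G] is infinite. *)
Let trunc (E : (set X)^nat) n x : R :=
  (fine (mine (G x) n%:R%:E) * \1_(E n) x)%R.

(** The inequality for functions below [G] is applied to the truncations, which increase to [G], and
    passes to the limit by monotone convergence. *)
Lemma minkowski_integral :
  (\int[nu]_x (\int[mu]_y (f (x, y))%:E) `^ q) `^ q^-1 <=
  \int[mu]_y (\int[nu]_x ((f (x, y)) `^ q)%:E) `^ q^-1.
Proof.
have /sigma_finiteP[E [TE ndE Eoo]] := sigma_finiteT nu.
pose h := trunc E; pose I := \int[mu]_y N y.
have I0 : 0 <= I by apply: integral_ge0 => y _; exact: poweR_ge0.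
have mE n : measurable (E n) by exact: (Eoo n).1.
have minf n x : (fine (mine (G x) n%:R%:E))%:E = mine (G x) n%:R%:E.
  rewrite fineK// ge0_fin_numE; last by rewrite le_min G0 lee_fin/=.
  by rewrite (@le_lt_trans _ _ n%:R%:E) ?ltry// ge_min lexx orbT.
have mh n : measurable_fun setT (h n).
  apply: measurable_funM => //; apply: measurableT_comp => //.
  exact: measurable_mine.
have h0 n x : (0 <= h n x)%R.
  rewrite /h /trunc mulr_ge0// ?indicE// fine_ge0// le_min G0 lee_fin.
  exact: ler0n.
have hG n x : (h n x)%:E <= G x.
  rewrite /h /trunc EFinM minf; apply: (@le_trans _ _ (mine (G x) n%:R%:E)).
    rewrite -[leRHS]mule1; apply: lee_wpmul2l.
      by rewrite le_min G0 lee_fin/=.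
    by rewrite lee_fin indicE lern1 leq_b1.
  by rewrite ge_min lexx.
have hn n x : (h n x <= n%:R * \1_(E n) x)%R.
  by rewrite ler_wpM2r ?indicE// -lee_fin minf ge_min lexx orbT.
have hnd x : nondecreasing_seq (h ^~ x).
  move=> m n mn; apply: ler_pM => //.
  - by rewrite fine_ge0// le_min G0 lee_fin/=.
  - by rewrite -lee_fin !minf le_min !ge_min lexx/= lee_fin ler_nat mn orbT.
  - rewrite !indicE; case: (boolP (x \in E m)) => // xEm.
    by rewrite (_ : x \in E n)// inE; apply/(subsetPset _ _ (ndE _ _ mn)); rewrite -inE.
have mhq n : measurable_fun setT (fun x => (h n x `^ q)%:E).
  apply/measurable_EFinP.
  exact: (@measurableT_comp _ _ _ _ _ _ (@powR R ^~ q)).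
have A n : \int[nu]_x (h n x `^ q)%:E <= I `^ q.
  rewrite -[leLHS]poweRe1; last first.
    by apply: integral_ge0 => x _; rewrite lee_fin powR_ge0.
  rewrite -(mulVf (lt0r_neq0 q0)) poweRrM; apply: gt0_ler_poweR.
  - exact: ltW.
  - by rewrite in_itv/= poweR_ge0 leey.
  - by rewrite in_itv/= I0 leey.
  apply: minkowski_below => //.
  apply: (@le_lt_trans _ _ (\int[nu]_x ((n%:R `^ q)%:E * (\1_(E n) x)%:E))).
    apply: ge0_le_integral => //.
    - by move=> x _; rewrite lee_fin powR_ge0.
    - by apply: measurable_funeM; apply/measurable_EFinP; exact: measurable_indic.
    move=> x _; rewrite -EFinM lee_fin.
    apply: (@le_trans _ _ ((n%:R * \1_(E n) x) `^ q)%R).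
      by apply: ge0_ler_powR; rewrite ?nnegrE ?(ltW q0)// mulr_ge0.
    rewrite powRM// indicE; case: (_ \in _); first by rewrite powR1.
    by rewrite powR0 ?gt_eqF.
  rewrite ge0_integralZl_EFin ?powR_ge0//; last first.
    by apply/measurable_EFinP; exact: measurable_indic.
  by rewrite integral_indic// setIT lte_mul_pinfty ?lee_fin ?powR_ge0//; exact: (Eoo n).2.
have ndq x : nondecreasing_seq (fun n => (h n x `^ q)%:E).
  by move=> m n mn; rewrite lee_fin ge0_ler_powR ?nnegrE ?(ltW q0)//; exact: hnd.
have limE x : limn (fun n => (h n x `^ q)%:E) = (G x) `^ q.
  rewrite (cvg_lim _ (ereal_nondecreasing_cvgn (ndq x)))//.
  apply/eqP; rewrite eq_le; apply/andP; split.
    apply: ge_ereal_sup => _ [n _ <-]; rewrite -poweR_EFin.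
    by apply: gt0_ler_poweR; rewrite ?in_itv/= ?leey ?andbT ?(ltW q0) ?lee_fin.
  have [m _ Em] : (\bigcup_i E i) x by rewrite -TE.
  have Emn n : (m <= n)%N -> \1_(E n) x = 1%R :> R.
    by move=> mn; rewrite indicE mem_set//; apply/(subsetPset _ _ (ndE _ _ mn)).
  have [Goo|Gfin] := eqVneq (G x) +oo.
    rewrite Goo poweRyr ?gt_eqF// leye_eq; apply/eqP/eqyP => r r0.
    (* Where [G x] is infinite the truncation equals n once x lies in [E n], and n^q >= n for n >=
       1. *)
    pose n := (maxn m (Num.truncn r).+1).
    apply: (@le_trans _ _ (h n x `^ q)%:E); last by apply: ereal_sup_ubound; exists n.
    have -> : h n x = n%:R.
      by rewrite /h /trunc Goo Emn ?leq_maxl// mulr1 minye.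
    have rn : (r <= n%:R)%R.
      by rewrite (le_trans (ltW (truncnS_gt r)))// ler_nat leq_maxr.
    rewrite lee_fin (le_trans rn)// le1r_powR// ler1n.
    by rewrite (leq_trans _ (leq_maxr _ _)).
  have Gf : G x \is a fin_num by rewrite ge0_fin_numE// ltey.
  pose n := (maxn m (Num.truncn (fine (G x))).+1).
  apply: ereal_sup_ubound; exists n => //.
  rewrite -[in RHS](fineK Gf) poweR_EFin; congr (_ `^ _)%:E.
  rewrite /h /trunc Emn ?leq_maxl// mulr1; congr fine; apply/min_idPl.
  rewrite -(fineK Gf) lee_fin (le_trans (ltW (truncnS_gt _)))// ler_nat.
  exact: leq_maxr.
have -> : \int[nu]_x (\int[mu]_y (f (x, y))%:E) `^ q =
    \int[nu]_x (limn (fun n => (h n x `^ q)%:E)).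
  by apply: eq_integral => x _; rewrite limE.
have IE : I = (I `^ q) `^ q^-1 by rewrite -poweRrM mulfV ?poweRe1// gt_eqF.
rewrite -/N -/I IE; apply: gt0_ler_poweR.
- by rewrite invr_ge0 ltW.
- rewrite in_itv/= leey andbT; apply: integral_ge0 => x _.
  by rewrite limE poweR_ge0.
- by rewrite in_itv/= poweR_ge0 leey.
rewrite monotone_convergence//.
apply: lime_le; last by near=> n; exact: A.
apply: ereal_nondecreasing_is_cvgn => m n mn; apply: ge0_le_integral => //.
  by move=> x _; rewrite lee_fin powR_ge0.
  by move=> x _; exact: ndq.
by move=> n x _; rewrite lee_fin powR_ge0.
Unshelve. all: by end_near. Qed.
End minkowski_integral.

(** * The kernel estimate *)

Lemma coord_normD (R : realType) (E : vectType R[i]) (u v : E) :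
  coord_norm (u + v) <= coord_norm u + coord_norm v.
Proof.
rewrite /coord_norm -big_split/=; apply: ler_sum => j _.
rewrite (rcoord_functional j).1 (icoord_functional j).1 addrACA.
by apply: lerD; exact: ler_normD.
Qed.

Lemma vmeasurableD (R : realType) d (T : measurableType d) (E : vectType R[i])
    (f g : T -> E) : vmeasurable f -> vmeasurable g -> vmeasurable (f \+ g).
Proof.
move=> mf mg j; have [rf jf] := mf j; have [rg jg] := mg j; split.
  rewrite (_ : re_coord _ _ = re_coord f j \+ re_coord g j).
    exact: measurable_funD.
  by apply/funext => x; exact: (rcoord_functional j).1.
rewrite (_ : im_coord _ _ = im_coord f j \+ im_coord g j).
  exact: measurable_funD.
by apply/funext => x; exact: (icoord_functional j).1.
Qed.

Section ae_domination.
Context (R : realType) d (T : measurableType d) (mu : {measure set T -> \bar R}).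
Variables (E : vectType R[i]) (f : T -> E) (h : T -> R).
Hypotheses (mf : vmeasurable f) (mh : measurable_fun setT h) (h0 : forall x, 0 <= h x).
Hypothesis fh : {ae mu, forall x, coord_norm (f x) <= h x}.
Hypothesis hoo : (\int[mu]_x (h x)%:E < +oo)%E.

(** Domination is only almost everywhere because the bound on K (x, y) says nothing at y = x. *)
Lemma vintegrable_ae_dominated : vintegrable mu setT f.
Proof.
have dom (phi : T -> R) : measurable_fun setT phi ->
    (forall x, `|phi x| <= coord_norm (f x)) -> mu.-integrable setT (EFin \o phi).
  move=> mphi phif; apply/integrableP; split; first exact/measurable_EFinP.
  apply: le_lt_trans hoo; apply: ae_ge0_le_integral => //.
  - by apply/measurable_EFinP; exact: measurableT_comp.
  - by move=> x _; rewrite lee_fin.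
  - exact/measurable_EFinP.
  - by apply: filterS fh => x fhx _; rewrite lee_fin (le_trans (phif x)).
move=> j; have [mr mi] := mf j; split; apply: dom => // x.
  exact: rcoord_le.
exact: icoord_le.
Qed.

Lemma coord_norm_vintegral_ae_dominated :
  ((coord_norm (vintegral mu f))%:E <= \int[mu]_x (h x)%:E)%E.
Proof.
apply: (le_trans (coord_norm_vintegral vintegrable_ae_dominated)).
apply: ae_ge0_le_integral => //.
- by move=> x _; rewrite lee_fin coord_norm_ge0.
- by apply/measurable_EFinP; exact: measurable_coord_norm.
- by move=> x _; rewrite lee_fin.
- exact/measurable_EFinP.
- by apply: filterS fh => x fhx _; rewrite lee_fin.
Qed.

End ae_domination.

Section kernel.
Context (R : realType) (N : nat) (l : R).
Hypothesis N0 : (0 < N)%N.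

(** A real power is finite at 0, so on the diagonal [kern] need not majorise K; comparisons with it
    are made for almost every y. *)
Definition kern (z : 'rV[R]_N * 'rV[R]_N) : R :=
  if 2 * enorm z.2 <= enorm z.1 then enorm z.2 * enorm z.1 `^ (- (N%:R - l + 1))
  else enorm (z.1 - z.2) `^ (l - N%:R).

Lemma kern_ge0 z : 0 <= kern z.
Proof. by rewrite /kern; case: ifP => _; rewrite ?mulr_ge0 ?powR_ge0 ?enorm_ge0. Qed.

Lemma measurable_kern : measurable_fun setT kern.
Proof.
have me1 : measurable_fun setT (fun z : 'rV[R]_N * 'rV[R]_N => enorm z.1).
  by apply: measurableT_comp; [exact: measurable_enorm|exact: measurable_fst].
have me2 : measurable_fun setT (fun z : 'rV[R]_N * 'rV[R]_N => enorm z.2).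
  by apply: measurableT_comp; [exact: measurable_enorm|exact: measurable_snd].
apply: measurable_fun_ifT.
- by apply: measurable_fun_ler => //; exact: measurable_funM.
- apply: measurable_funM => //.
  exact: (@measurableT_comp _ _ _ _ _ _ (@powR R ^~ _)).
- apply: (@measurableT_comp _ _ _ _ _ _ (@powR R ^~ _)) => //.
  apply: measurableT_comp; first exact: measurable_enorm.
  by apply: measurable_sub_rV; [exact: measurable_fst|exact: measurable_snd].
Qed.

Section pointwise.
Variables (F V : vectType R[i]) (nF : F -> R) (nV : V -> R).
Hypotheses (hnF : is_norm nF) (hnV : is_norm nV).
Variables (K : 'rV[R]_N * 'rV[R]_N -> 'Hom(F, V)).
Hypothesis mK : vmeasurable K.
Variables (C1 C2 : R).
Hypotheses (hC1 : 0 < C1) (hC2 : 0 < C2).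
Hypothesis hK1 : forall x y : 'rV[R]_N, x != y ->
     op_norm nF nV (K (x, y)) <= C1 * enorm (x - y) `^ (l - N%:R).
Hypothesis hK2 : forall x y : 'rV[R]_N, 2 * enorm y <= enorm x ->
     op_norm nF nV (K (x, y) - K (x, 0)) <=
       C2 * (enorm y / enorm x `^ (N%:R - l + 1)).
Variables (k : nat) (b : multi_index N k -> 'Hom(F, V)).
Hypothesis hb : cocanceling b.
Local Notation mu := (lebesgue_rV R N).

Lemma op_norm_coord : exists2 M, 0 < M & forall (A : 'Hom(F, V)) v,
  coord_norm (A v) <= M * op_norm nF nV A * coord_norm v.
Proof.
have [M M0 HM] := coord_norm_le_norm hnV.
have [_ nFD nFZ] := hnF.
have [M' M'0 HM'] := seminorm_le_coord_norm nFD nFZ.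
exists (M * M') => [|A v]; first exact: mulr_gt0.
rewrite (le_trans (HM _))// -!mulrA ler_pM2l//.
rewrite (le_trans (op_norm_app hnF hnV A v))//.
by rewrite mulrCA ler_wpM2l// op_norm_ge0.
Qed.

(** Finiteness of the majorant at x makes the integral of the difference kernel converge, and the
    term with K (x, 0) has a compactly supported factor; integrability and the bound then hold for
    the sum. *)
Lemma pointwise_bound : exists2 M, 0 < M & forall g, distributional_kernel b g ->
  forall x, (\int[mu]_y (kern (x, y) * coord_norm (g y))%:E < +oo)%E ->
  vintegrable mu setT (fun y => K (x, y) (g y)) /\
  ((nV (vintegral mu (fun y => K (x, y) (g y))))%:E <=
     M%:E * \int[mu]_y (kern (x, y) * coord_norm (g y))%:E)%E.
Proof.
have [c0 c00 Hc] := op_norm_coord.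
have [P P0 psiP] := psi_lipschitz R N0.
have [A A0 HA] := moment_estimate N0 hnV hb.
have [_ nVD nVZ] := hnV.
have [B B0 HB] := seminorm_le_coord_norm nVD nVZ.
(* [C1] is for K (x, y) where 2 |y| > |x|; elsewhere [C2] is for K (x, y) - K (x, 0) and [P * C1]
   for (1 - psi) K (x, 0). *)
pose D := c0 * (C1 + C2 + P * C1).
have D0 : 0 < D by rewrite mulr_gt0// !addr_gt0// mulr_gt0.
(* [D] belongs to the difference kernel, [c0 * C1 * A] to the moment term, and [B] returns from
   [coord_norm] to [nV]. *)
exists (B * (D + c0 * C1 * A)) => [|g kg x Goo].
  by rewrite mulr_gt0// addr_gt0// !mulr_gt0.
have [[mg lg] _] := kg.
set G := (\int[mu]_y _)%E in Goo *.
have G0 : (0 <= G)%E.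
  by apply: integral_ge0 => y _; rewrite lee_fin mulr_ge0 ?kern_ge0 ?coord_norm_ge0.
have mh : measurable_fun setT (fun y => kern (x, y) * coord_norm (g y)).
  apply: measurable_funM; last exact: measurable_coord_norm.
  exact: (measurable_fun_pair2 x measurable_kern).
have mDh : measurable_fun setT (fun y => D * (kern (x, y) * coord_norm (g y))).
  exact: measurable_funM.
have IDh : (\int[mu]_y (D * (kern (x, y) * coord_norm (g y)))%:E = D%:E * G)%E.
  under eq_integral do rewrite EFinM.
  rewrite ge0_integralZl_EFin ?(ltW D0)//; last exact/measurable_EFinP.
  by move=> y _; rewrite lee_fin mulr_ge0 ?kern_ge0 ?coord_norm_ge0.
have DGoo : (\int[mu]_y (D * (kern (x, y) * coord_norm (g y)))%:E < +oo)%E.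
  by rewrite IDh lte_mul_pinfty// lee_fin ltW.
have Dh0 y : 0 <= D * (kern (x, y) * coord_norm (g y)).
  by rewrite mulr_ge0 ?(ltW D0)// mulr_ge0 ?kern_ge0 ?coord_norm_ge0.
have mKx : vmeasurable (fun y => K (x, y)).
  move=> j; have [mr mi] := mK j; split.
    exact: (measurable_fun_pair2 x mr).
  exact: (measurable_fun_pair2 x mi).
have mKg : vmeasurable (fun y => K (x, y) (g y)) by exact: vmeasurable_app.
have ae_neq : {ae mu, forall y, x != y}.
  exists [set x]; split.
  - exact: measurable_rV_set1.
  - exact: lebesgue_rV_set1.
  - by move=> y /= /negP; rewrite negbK => /eqP.
have far y : x != y -> enorm x < 2 * enorm y ->
    coord_norm (K (x, y) (g y)) <= D * (kern (x, y) * coord_norm (g y)).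
  move=> xy xlt; rewrite (le_trans (Hc _ _))// mulrA ler_wpM2r ?coord_norm_ge0//.
  have nle : (2 * enorm y <= enorm x) = false by apply/negbTE; rewrite -ltNge.
  rewrite /kern/= nle /D -[leRHS]mulrA ler_pM2l// (le_trans (hK1 xy))//.
  by rewrite ler_wpM2r ?powR_ge0// -addrA lerDl addr_ge0// ?mulr_ge0// ltW.
have conclude v : ((coord_norm v)%:E <= (D + c0 * C1 * A)%:E * G)%E ->
    ((nV v)%:E <= (B * (D + c0 * C1 * A))%:E * G)%E.
  move=> vG; rewrite EFinM -muleA (@le_trans _ _ (B%:E * (coord_norm v)%:E)%E)//.
    by rewrite -EFinM lee_fin.
  by rewrite lee_wpmul2l// lee_fin ltW.
(* At x = 0 there is no scale r, but 0 < 2 |y| for all y != 0, so the bound [far] already covers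
   almost every y. *)
have [x0|x0] := eqVneq x 0.
  have aeb : {ae mu, forall y, coord_norm (K (x, y) (g y)) <= D * (kern (x, y) * coord_norm (g y))}.
    apply: filterS ae_neq => y xy; apply: far => //.
    rewrite x0 enorm0 mulr_gt0// enorm_gt0//.
    by rewrite x0 eq_sym in xy.
  have vKg := vintegrable_ae_dominated mKg mDh Dh0 aeb DGoo.
  split => //; apply: conclude.
  rewrite (le_trans (coord_norm_vintegral_ae_dominated mKg mDh Dh0 aeb DGoo))//.
  by rewrite IDh lee_wpmul2r// lee_fin lerDl ?mulr_ge0// ltW.
have xp := enorm_gt0 x0; set r := enorm x in xp.
pose f2 y := (psi (r^-1 *: y))%:C%C *: K (x, 0) (g y).
pose fD y := K (x, y) (g y) + (- psi (r^-1 *: y))%:C%C *: K (x, 0) (g y).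
have scale_enorm y : enorm (r^-1 *: y :> 'rV[R]_N) = r^-1 * enorm y.
  by rewrite enormZ gtr0_norm ?invr_gt0.
have psi0 y : r < 2 * enorm y -> psi (r^-1 *: y :> 'rV[R]_N) = 0.
  move=> ry; apply: psi_support => //.
  by rewrite scale_enorm mulrCA -ltr_pdivrMl ?invr_gt0// invrK mulr1.
have mpsi : measurable_fun setT (fun y : 'rV[R]_N => psi (r^-1 *: y)).
  exact: (measurable_cutoff_mon_prod N0 r (fun=> 0%N) (fun=> 0%N)).
have mK0g : vmeasurable (fun y => K (x, 0) (g y)).
  exact: (vmeasurable_linear (real_linear_hom (K (x, 0)))).
have mfD : vmeasurable fD.
  apply: vmeasurableD => //; apply: vmeasurable_scale => //.
  exact: measurableT_comp.
have opx0 : op_norm nF nV (K (x, 0)) <= C1 * r `^ (l - N%:R).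
  by have := hK1 x0; rewrite subr0.
(* This turns |y| / r times the size of K (x, 0) into the first branch of [kern]. *)
have rpow : r^-1 * r `^ (l - N%:R) = r `^ (- (N%:R - l + 1)).
  rewrite -powR_inv1 ?(ltW xp)// -powRD; last by apply/implyP => _; rewrite gt_eqF.
  by congr (_ `^ _); ring.
have near_bound y : 2 * enorm y <= r ->
    coord_norm (fD y) <= D * (kern (x, y) * coord_norm (g y)).
  move=> yr; rewrite (_ : fD y = (K (x, y) - K (x, 0)) (g y) +
      (1 - psi (r^-1 *: y))%:C%C *: K (x, 0) (g y)); last first.
    rewrite /fD add_lfunE opp_lfunE rmorphN rmorphB scaleNr scalerBl rmorph1 scale1r.
    by rewrite addrA subrK.
  rewrite (le_trans (coord_normD _ _))// coord_normZ.
  apply: (@le_trans _ _ (c0 * (C2 * (enorm y / r `^ (N%:R - l + 1))) * coord_norm (g y) +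
     (P * (r^-1 * enorm y)) * (c0 * (C1 * r `^ (l - N%:R)) * coord_norm (g y)))).
    apply: lerD.
      rewrite (le_trans (Hc _ _))// ler_wpM2r ?coord_norm_ge0// ler_pM2l//.
      exact: hK2.
    rewrite ler_pM ?coord_norm_ge0//.
      by rewrite -scale_enorm; exact: (psiP _).2.
    by rewrite (le_trans (Hc _ _))// ler_wpM2r ?coord_norm_ge0// ler_pM2l.
  rewrite /kern/= yr -powRN.
  rewrite (_ : P * _ * _ = P * c0 * C1 * enorm y * coord_norm (g y) * (r^-1 * r `^ (l - N%:R))); last by ring.
  rewrite rpow -subr_ge0 /D.
  (* [D] exceeds what is needed here by [c0 * C1], its share for the other zone. *)
  set u := _ `^ _; rewrite (_ : _ - _ = c0 * C1 * (enorm y * u * coord_norm (g y))); last by ring.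
  by rewrite !mulr_ge0 ?enorm_ge0 ?coord_norm_ge0 ?powR_ge0// ltW.
have aeD : {ae mu, forall y, coord_norm (fD y) <= D * (kern (x, y) * coord_norm (g y))}.
  apply: filterS ae_neq => y xy; have [yr|ry] := leP (2 * enorm y) r.
    exact: near_bound.
  by rewrite /fD psi0// oppr0 rmorph0 scale0r addr0; exact: far.
have vfD := vintegrable_ae_dominated mfD mDh Dh0 aeD DGoo.
have cfD := coord_norm_vintegral_ae_dominated mfD mDh Dh0 aeD DGoo.
have vpsi : vintegrable mu setT (fun y => (psi (r^-1 *: y))%:C%C *: g y).
  apply: (@vintegrable_local _ _ _ _ _ P r) => // y; first exact: (psiP _).1.
  move=> ry; apply: psi0; rewrite (lt_le_trans ry)//.
  by rewrite mulr2n mulrDl mul1r lerDl enorm_ge0.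
have f2E : f2 = K (x, 0) \o (fun y => (psi (r^-1 *: y))%:C%C *: g y).
  by apply/funext => y; rewrite /f2 /= linearZ.
have vf2 : vintegrable mu setT f2.
  by rewrite f2E; apply: (vintegrable_linear (real_linear_hom (K (x, 0)))).
have KgE : (fun y => K (x, y) (g y)) = fD \+ f2.
  by apply/funext => y; rewrite /fD /f2 /= rmorphN scaleNr subrK.
have vKg : vintegrable mu setT (fun y => K (x, y) (g y)).
  by rewrite KgE; exact: vintegrableD.
split => //; apply: conclude; rewrite KgE vintegralD//.
apply: (@le_trans _ _ ((coord_norm (vintegral mu fD))%:E + (coord_norm (vintegral mu f2))%:E)%E).
  by rewrite -EFinD lee_fin coord_normD.
rewrite EFinD ge0_muleDl ?lee_fin ?(ltW D0) ?mulr_ge0 ?(ltW A0) ?(ltW hC1) ?(ltW c00)//.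
apply: leeD; first by rewrite -IDh.
rewrite f2E (vintegral_linear (real_linear_hom (K (x, 0)))) //.
apply: (@le_trans _ _ ((c0 * (C1 * r `^ (l - N%:R)))%:E *
   (coord_norm (vintegral mu (fun y => (psi (r^-1 *: y))%:C%C *: g y)))%:E)%E).
  rewrite -EFinM lee_fin (le_trans (Hc _ _))// ler_wpM2r ?coord_norm_ge0//.
  by rewrite ler_pM2l.
set u := r `^ _ in opx0 rpow *.
have u0 : 0 <= u by exact: powR_ge0.
apply: (@le_trans _ _ ((c0 * (C1 * u))%:E * (A%:E *
   \int[mu]_(y in [set y | (2 * enorm y <= r)%R]) (r^-1 * enorm y * coord_norm (g y))%:E))%E).
  apply: lee_wpmul2l; last exact: HA.
  by rewrite lee_fin !mulr_ge0// ltW.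
have mY : measurable [set y : 'rV[R]_N | 2 * enorm y <= r].
  rewrite (_ : mkset _ = (@enorm R N) @^-1` `]-oo, (r / 2)]%classic).
    by rewrite -[X in measurable X]setTI; apply: measurable_enorm.
  by apply/seteqP; split=> y; rewrite /= in_itv/= ler_pdivlMr// mulrC.
rewrite muleA -EFinM (_ : c0 * (C1 * u) * A = c0 * C1 * A * u); last by ring.
rewrite EFinM -muleA; apply: lee_wpmul2l; first by rewrite lee_fin !mulr_ge0// ltW.
have m0 y : 0 <= r^-1 * enorm y * coord_norm (g y).
  by rewrite mulr_ge0 ?coord_norm_ge0// mulr_ge0 ?enorm_ge0// invr_ge0 ltW.
have mm : measurable_fun setT (fun y => (r^-1 * enorm y * coord_norm (g y))%:E).
  apply/measurable_EFinP; apply: measurable_funM; last exact: measurable_coord_norm.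
  by apply: measurable_funM => //; exact: measurable_enorm.
rewrite -(ge0_integralZl_EFin _ mY) //; last exact: measurable_funTS.
rewrite [leLHS]integral_mkcond; apply: ge0_le_integral => //.
- move=> y _; rewrite patchE; case: ifP => // _.
  by rewrite -EFinM lee_fin mulr_ge0.
- apply/(measurable_restrictT _ mY); apply: measurable_funeM.
  exact: measurable_funTS.
- exact/measurable_EFinP.
move=> y _; rewrite patchE; case: ifPn => [|_]; last first.
  by rewrite lee_fin mulr_ge0 ?kern_ge0 ?coord_norm_ge0.
rewrite inE /= => yr; rewrite -EFinM lee_fin /kern/= yr -rpow.
by rewrite le_eqVlt; apply/orP; left; apply/eqP; ring.
by move=> y _; rewrite lee_fin.
Qed.


End pointwise.
End kernel.

(* Unlike [ge0_le_integral], no measurability is required: the integral of a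
   nonnegative function is a supremum over the simple functions below it. *)
Lemma ge0_le_integral_nomeas (R : realType) d (T : measurableType d)
    (mu : {measure set T -> \bar R}) (f1 f2 : T -> \bar R) :
  (forall x, 0 <= f1 x)%E -> (forall x, f1 x <= f2 x)%E ->
  (\int[mu]_x f1 x <= \int[mu]_x f2 x)%E.
Proof.
move=> f10 f12; rewrite !ge0_integralTE//; last first.
  by move=> x; exact: le_trans (f12 x).
apply: le_ereal_sup => _ [h hf1 <-] /=.
by exists h => // x; exact: le_trans (f12 x).
Qed.

(** * The L^q(nu) norm of the kernel in its first variable *)

Section kernel_norm.
Context (R : realType) (N : nat) (l q : R).
Hypothesis hq : 1 <= q.
Variables (nu : {measure set 'rV[R]_N -> \bar R}) (C3 C4 : R).
Hypotheses (hC3 : 0 < C3) (hC4 : 0 < C4).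

(** The branches of [kern] live on |x| >= 2 |y| and on its complement, and each is controlled there
    by one of the two conditions on w and nu; t stands for the size of g at y. *)
Lemma kern_norm (y : 'rV[R]_N) (wy t : R) : 0 <= t ->
  ((\int[nu]_(x in ~` eball 0 (2 * enorm y))
         ((enorm x `^ ((N%:R - l + 1) * q))%:E)^-1) `^ q^-1
      <= (C3 * (wy / enorm y))%:E)%E ->
  ((\int[nu]_(x in eball 0 (4 * enorm y))
         ((enorm (x - y) `^ ((N%:R - l) * q))%:E)^-1) `^ q^-1
      <= (C4 * wy)%:E)%E ->
  ((\int[nu]_x ((kern l (x, y) * t) `^ q)%:E) `^ q^-1 <= (2 * (C3 + C4) * wy * t)%:E)%E.
Proof.
move=> t0 h1 h2; have q0 : 0 < q by exact: lt_le_trans hq.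
have w0 : 0 <= wy.
  have := le_trans (poweR_ge0 _ _) h2.
  by rewrite lee_fin pmulr_rge0.
have unroot (I : \bar R) (a : R) : (0 <= I)%E -> (I `^ q^-1 <= a%:E)%E -> (I <= (a `^ q)%:E)%E.
  move=> I0 Ia; rewrite -[leLHS]poweRe1// -(mulVf (lt0r_neq0 q0)) poweRrM -poweR_EFin.
  apply: gt0_ler_poweR => //; first exact: ltW.
    by rewrite in_itv/= poweR_ge0 leey.
  by rewrite in_itv/= (le_trans (poweR_ge0 _ _) Ia) leey.
have inv_ge0 (a : R) : 0 <= a -> (0 <= (a%:E)^-1)%E.
  by move=> a0; rewrite inve_ge0 lee_fin.
(* Where the power vanishes, the extended inverse on the right is infinite and the real power on the
   left finite; elsewhere the two sides agree. *)
have powV (a s : R) : ((a `^ (- s))%:E <= ((a `^ s)%:E)^-1)%E.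
  by rewrite powRN inver; case: ifP => _; rewrite ?leey.
set S := ~` eball 0 (2 * enorm y) in h1.
have SE x : S x <-> 2 * enorm y <= enorm x.
  by rewrite /S /eball /= subr0; split=> [/negP|xy]; [rewrite -leNgt|apply/negP; rewrite -leNgt].
have mS : measurable S.
  rewrite (_ : S = (@enorm R N) @^-1` `[2 * enorm y, +oo[%classic).
    by rewrite -[X in measurable X]setTI; apply: measurable_enorm.
  by apply/seteqP; split=> x; rewrite /= in_itv/= andbT => /SE.
have mF : measurable_fun setT (fun x => ((kern l (x, y) * t) `^ q)%:E).
  apply/measurable_EFinP.
  apply: (@measurableT_comp _ _ _ _ _ _ (@powR R ^~ q)) => //.
  apply: measurable_funM => //.
  exact: (measurable_fun_pair1 y (@measurable_kern R N l)).
have F0 x : (0 <= ((kern l (x, y) * t) `^ q)%:E)%E by rewrite lee_fin powR_ge0.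
pose s := (N%:R - l + 1) * q.
have mep p : measurable_fun setT (fun x : 'rV[R]_N => (enorm x `^ p)%:E).
  apply/measurable_EFinP.
  apply: (@measurableT_comp _ _ _ _ _ _ (@powR R ^~ p)) => //.
  exact: measurable_enorm.
have mep' p : measurable_fun setT (fun x : 'rV[R]_N => (enorm (x - y) `^ p)%:E).
  apply/measurable_EFinP.
  apply: (@measurableT_comp _ _ _ _ _ _ (@powR R ^~ p)) => //.
  by apply: measurableT_comp; [exact: measurable_enorm|exact: measurable_sub_rV].
have far : (\int[nu]_(x in S) ((kern l (x, y) * t) `^ q)%:E <= ((C3 * wy * t) `^ q)%:E)%E.
  have I1 : (\int[nu]_(x in S) (enorm x `^ (- s))%:E <= ((C3 * (wy / enorm y)) `^ q)%:E)%E.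
    apply: unroot; first by apply: integral_ge0 => x _; rewrite lee_fin powR_ge0.
    apply: le_trans h1; apply: gt0_ler_poweR; rewrite ?invr_ge0 ?(ltW q0)//.
    - rewrite in_itv/= leey andbT; apply: integral_ge0 => x _.
      by rewrite lee_fin powR_ge0.
    - rewrite in_itv/= leey andbT; apply: integral_ge0 => x _.
      by apply: inv_ge0; rewrite powR_ge0.
    rewrite integral_mkcond [leRHS]integral_mkcond.
    by apply: ge0_le_integral_nomeas => x; rewrite !patchE; case: ifP => //; rewrite lee_fin powR_ge0.
  rewrite (eq_integral (fun x => ((enorm y * t) `^ q)%:E * (enorm x `^ (- s))%:E)%E); last first.
    move=> x; rewrite inE => /SE yx; rewrite /kern /= yx -EFinM; congr EFin.
    transitivity ((enorm y * t * enorm x `^ (- (N%:R - l + 1))) `^ q).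
      by congr (_ `^ _); ring.
    by rewrite powRM ?mulr_ge0 ?enorm_ge0 ?powR_ge0// -[in LHS]powRrM /s mulNr.
  rewrite ge0_integralZl_EFin ?powR_ge0//; last 2 first.
  - by move=> x _; rewrite lee_fin powR_ge0.
  - exact: measurable_funTS.
  (* The factor |y| cancels against wy / |y| only if it is nonzero; for |y| = 0 the integrand is
     0. *)
  have [y0|y0] := eqVneq (enorm y) 0.
    by rewrite y0 mul0r powR0 ?gt_eqF// mul0e lee_fin powR_ge0.
  apply: (@le_trans _ _ (((enorm y * t) `^ q)%:E * ((C3 * (wy / enorm y)) `^ q)%:E)%E).
    by apply: lee_wpmul2l => //; rewrite lee_fin powR_ge0.
  rewrite -EFinM lee_fin -powRM ?mulr_ge0 ?enorm_ge0 ?invr_ge0 ?enorm_ge0 ?(ltW hC3)//.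
  rewrite (_ : _ * (C3 * _) = C3 * wy * t)//.
  by field.
have near : (\int[nu]_(x in ~` S) ((kern l (x, y) * t) `^ q)%:E <= ((C4 * wy * t) `^ q)%:E)%E.
  have I2 : (\int[nu]_(x in ~` S) (enorm (x - y) `^ ((l - N%:R) * q))%:E <= ((C4 * wy) `^ q)%:E)%E.
    apply: unroot; first by apply: integral_ge0 => x _; rewrite lee_fin powR_ge0.
    apply: le_trans h2; apply: gt0_ler_poweR; rewrite ?invr_ge0 ?(ltW q0)//.
    - rewrite in_itv/= leey andbT; apply: integral_ge0 => x _.
      by rewrite lee_fin powR_ge0.
    - rewrite in_itv/= leey andbT; apply: integral_ge0 => x _.
      by apply: inv_ge0; rewrite powR_ge0.
    rewrite integral_mkcond [leRHS]integral_mkcond.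
    apply: ge0_le_integral_nomeas => x; rewrite !patchE.
      by case: ifP => //; rewrite lee_fin powR_ge0.
    case: ifPn => [|_]; last first.
      by case: ifP => // _; apply: inv_ge0; rewrite powR_ge0.
    (* Off [S], |x| < 2 |y|, so x lies in the ball of radius 4 |y|. *)
    rewrite inE => nSx; rewrite ifT; last first.
      rewrite inE /eball /= subr0.
      have : enorm x < 2 * enorm y by rewrite ltNge; apply/negP => /SE.
      by move/lt_le_trans; apply; rewrite ler_wpM2r ?enorm_ge0// ler_nat.
    by rewrite (_ : (l - N%:R) * q = - ((N%:R - l) * q)) ?powV//; ring.
  rewrite (eq_integral (fun x : 'rV[R]_N =>
    (t `^ q)%:E * (enorm (x - y) `^ ((l - N%:R) * q))%:E)%E); last first.
    move=> x; rewrite inE => nSx; rewrite /kern /=.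
    rewrite (_ : (_ <= _) = false); last by apply/negP => /SE.
    by rewrite -EFinM mulrC powRM ?powR_ge0// -powRrM.
  rewrite ge0_integralZl_EFin ?powR_ge0//; last 3 first.
  - exact: measurableC.
  - by move=> x _; rewrite lee_fin powR_ge0.
  - exact: measurable_funTS.
  rewrite [C4 * wy * t]mulrC powRM ?mulr_ge0 ?(ltW hC4)// EFinM.
  by apply: lee_wpmul2l => //; rewrite lee_fin powR_ge0.
have total : (\int[nu]_x ((kern l (x, y) * t) `^ q)%:E <= ((2 * (C3 + C4) * wy * t) `^ q)%:E)%E.
  rewrite -(setUv S) ge0_integral_setU//; last 3 first.
  - exact: measurableC.
  - by rewrite setUv.
  - by apply/disj_setPCl.
  apply: (le_trans (leeD far near)); rewrite -EFinD lee_fin.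
  have mono a : 0 <= a -> a <= C3 + C4 -> (a * wy * t) `^ q <= ((C3 + C4) * wy * t) `^ q.
    move=> a0 aC; apply: ge0_ler_powR; first exact: ltW.
    - by rewrite nnegrE !mulr_ge0.
    - by rewrite nnegrE !mulr_ge0// addr_ge0// ltW.
    - by do 2 apply: ler_wpM2r => //.
  (* Each zone contributes at most ((C3 + C4) wy t)^q, and 2 <= 2^q because 1 <= q. *)
  apply: (@le_trans _ _ (2 * ((C3 + C4) * wy * t) `^ q)).
    rewrite mulr2n mulrDl mul1r lerD// mono ?ltW//.
      by rewrite ltrDl.
    by rewrite ltrDr.
  have Y0 : 0 <= (C3 + C4) * wy * t by rewrite !mulr_ge0// addr_ge0// ltW.
  rewrite (_ : 2 * (C3 + C4) * wy * t = 2 * ((C3 + C4) * wy * t)); last by ring.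
  rewrite [leRHS]powRM//; apply: ler_wpM2r; first exact: powR_ge0.
  by rewrite le1r_powR// ler1n.
have Z0 : 0 <= 2 * (C3 + C4) * wy * t.
  by rewrite !mulr_ge0// addr_ge0// ltW.
move: Z0 total; set Z := 2 * _ * _ * _ => Z0 total.
have -> : Z%:E = ((Z `^ q)%:E `^ q^-1)%E.
  by rewrite -poweR_EFin -poweRrM mulfV ?gt_eqF// poweRe1.
apply: gt0_ler_poweR => //; first by rewrite invr_ge0 ltW.
  by rewrite in_itv/= leey andbT integral_ge0.
by rewrite in_itv/= leey andbT lee_fin powR_ge0.
Qed.

End kernel_norm.

Theorem lemma4p1 (R : realType) (N : nat) (hN : (2 <= N)%N)
  (l : R) (hl0 : 0 < l) (hlN : l < N%:R)
  (F V : vectType R[i]) (nF : F -> R) (nV : V -> R)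
  (hnF : is_norm nF) (hnV : is_norm nV)
  (K : 'rV[R]_N * 'rV[R]_N -> 'Hom(F, V)) (hK : vlocally_integrable2 K)
  (C1 C2 : R) (hC1 : 0 < C1) (hC2 : 0 < C2)
  (hK1 : forall x y : 'rV[R]_N, x != y ->
     op_norm nF nV (K (x, y)) <= C1 * enorm (x - y) `^ (l - N%:R))
  (hK2 : forall x y : 'rV[R]_N, 2 * enorm y <= enorm x ->
     op_norm nF nV (K (x, y) - K (x, 0)) <=
       C2 * (enorm y / enorm x `^ (N%:R - l + 1)))
  (q : R) (hq : 1 <= q)
  (w : 'rV[R]_N -> R) (hw : is_weight w)
  (nu : {sigma_finite_measure set 'rV[R]_N -> \bar R})
  (C3 C4 : R) (hC3 : 0 < C3) (hC4 : 0 < C4)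
  (hnu1 : {ae lebesgue_rV R N, forall y : 'rV[R]_N,
     ((\int[nu]_(x in ~` eball 0 (2 * enorm y))
         ((enorm x `^ ((N%:R - l + 1) * q))%:E)^-1) `^ q^-1
      <= (C3 * (w y / enorm y))%:E)%E})
  (hnu2 : {ae lebesgue_rV R N, forall y : 'rV[R]_N,
     ((\int[nu]_(x in eball 0 (4 * enorm y))
         ((enorm (x - y) `^ ((N%:R - l) * q))%:E)^-1) `^ q^-1
      <= (C4 * w y)%:E)%E})
  (k : nat) (b : multi_index N k -> 'Hom(F, V)) (hb : cocanceling b) :
  exists2 C : R, 0 < C &
    forall g : 'rV[R]_N -> F,
      in_weighted_L1 nF w g -> distributional_kernel b g ->
      {ae nu, forall x : 'rV[R]_N,
         vintegrable (lebesgue_rV R N) setT (fun y => K (x, y) (g y))} /\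
      ((\int[nu]_x
          (nV (vintegral (lebesgue_rV R N) (fun y => K (x, y) (g y))) `^ q)%:E)
         `^ q^-1
       <= C%:E * \int[lebesgue_rV R N]_x (nF (g x) * w x)%:E)%E.
Proof.
have N0 : (0 < N)%N by exact: ltn_trans hN.
have q0 : 0 < q by exact: lt_le_trans hq.
have [M M0 HM] := pointwise_bound N0 hnF hnV hK.1 hC1 hC2 hK1 hK2 hb.
have [B B0 HB] := coord_norm_le_norm hnF.
pose W := 2 * (C3 + C4).
have W0 : 0 < W by rewrite mulr_gt0// addr_gt0.
(* [M] comes from the pointwise bound, [W] from [kern_norm], and [B] passes from [coord_norm] to
   [nF]. *)
exists (M * (W * B)) => [|g [mg gw] kg]; first by rewrite mulr_gt0// mulr_gt0.
set mu := lebesgue_rV R N in gw *.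
pose f (z : 'rV[R]_N * 'rV[R]_N) := kern l z * coord_norm (g z.2).
have f0 z : 0 <= f z by rewrite mulr_ge0 ?kern_ge0 ?coord_norm_ge0.
have mcn : measurable_fun setT (fun y => coord_norm (g y)) by exact: measurable_coord_norm.
have mf : measurable_fun setT f.
  apply: measurable_funM; first exact: measurable_kern.
  by apply: (measurableT_comp mcn); exact: measurable_snd.
have [mw _ w0] := hw.
have mgw : measurable_fun setT (fun y => nF (g y) * w y).
  by apply: measurable_funM => //; exact: (measurable_norm hnF mg).
(* w is positive only almost everywhere; the absolute value makes the integrand nonnegative
   everywhere without changing the integral. *)
pose J := (\int[mu]_y (`|nF (g y) * w y|)%:E)%E.
have IE : J = (\int[mu]_y (nF (g y) * w y)%:E)%E.
  apply: ae_eq_integral => //.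
  - by apply/measurable_EFinP; exact: measurableT_comp.
  - exact/measurable_EFinP.
  - apply: filterS w0 => y wy _; rewrite ger0_norm// mulr_ge0 ?(ltW wy)//.
    exact: norm_ge0.
pose G x := (\int[mu]_y (f (x, y))%:E)%E.
have G0 x : (0 <= G x)%E by apply: integral_ge0 => y _; rewrite lee_fin.
have GI : ((\int[nu]_x (G x `^ q)) `^ q^-1 <= (W * B)%:E * J)%E.
  apply: (le_trans (minkowski_integral nu mu mf f0 hq)).
  rewrite -ge0_integralZl_EFin//; last 2 first.
  - by apply/measurable_EFinP; exact: measurableT_comp.
  - by rewrite mulr_ge0// ltW.
  apply: ae_ge0_le_integral => //.
  - by move=> y _; exact: poweR_ge0.
  - exact: measurable_section_norm.
  - by move=> y _; rewrite -EFinM lee_fin; apply: mulr_ge0 => //; exact/ltW/mulr_gt0.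
  - by apply: measurable_funeM; apply/measurable_EFinP; exact: measurableT_comp.
  apply: filterS3 hnu1 hnu2 w0 => y h1 h2 wy _.
  apply: (le_trans (kern_norm hq hC3 hC4 (coord_norm_ge0 (g y)) h1 h2)).
  rewrite -EFinM lee_fin -/W ger0_norm; last first.
    by rewrite mulr_ge0 ?(ltW wy)// (norm_ge0 _ hnF).
  rewrite (_ : W * B * _ = W * w y * (B * nF (g y))); last by ring.
  apply: ler_wpM2l; last exact: HB.
  by apply: mulr_ge0; exact: ltW.
have Ioo : (J < +oo)%E by rewrite IE.
have mG : measurable_fun setT G.
  apply: (measurable_fun_fubini_tonelli_F (EFin \o f)); first exact/measurable_EFinP.
  by move=> z; rewrite lee_fin.
have mGq : measurable_fun setT (fun x => (G x `^ q)%E).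
  by apply: (@measurableT_comp _ _ _ _ _ _ (fun x : \bar R => (x `^ q)%E)) => //; exact: measurable_poweR.
split.
  (* [G] has finite L^q(nu) norm, hence is finite almost everywhere, and at such points the
     pointwise bound gives integrability. *)
  have iGq : nu.-integrable setT (fun x => (G x `^ q)%E).
    apply/integrableP; split => //.
    rewrite (eq_integral (fun x => (G x `^ q)%E)); last first.
      by move=> x _; rewrite gee0_abs// poweR_ge0.
    apply: (@lty_poweRy _ _ q^-1); first by rewrite invr_eq0 gt_eqF.
    by rewrite (le_lt_trans GI)// lte_mul_pinfty// lee_fin mulr_ge0// ltW.
  apply: filterS (integrable_ae measurableT iGq) => x /(_ I) Gx.
  apply: (HM g kg x _).1; apply: (@lty_poweRy _ _ q); first by rewrite gt_eqF.
  by rewrite -ge0_fin_numE// poweR_ge0.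
rewrite -IE EFinM -muleA.
have Mq : (\int[nu]_x ((M%:E * G x) `^ q) = (M%:E `^ q) * \int[nu]_x (G x `^ q))%E.
  under eq_integral do rewrite poweRM ?lee_fin ?(ltW M0)//.
  by rewrite ge0_integralZl ?poweR_ge0// => x _; exact: poweR_ge0.
apply: (@le_trans _ _ ((\int[nu]_x ((M%:E * G x) `^ q)) `^ q^-1)%E).
  apply: gt0_ler_poweR; first by rewrite invr_ge0 ltW.
  - rewrite in_itv/= leey andbT; apply: integral_ge0 => x _.
    by rewrite lee_fin powR_ge0.
  - by rewrite in_itv/= leey andbT; apply: integral_ge0 => x _; exact: poweR_ge0.
  apply: ge0_le_integral_nomeas => x; first by rewrite lee_fin powR_ge0.
  (* Where [G x] is infinite so is the majorant; elsewhere the pointwise bound applies. *)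
  have [Gx|Gx] := ltP (G x) +oo%E; last first.
    move: Gx; rewrite leye_eq => /eqP ->.
    by rewrite gt0_muley ?lte_fin// poweRyr ?gt_eqF// leey.
  rewrite -poweR_EFin; apply: gt0_ler_poweR; first exact: ltW.
  - by rewrite in_itv/= lee_fin (norm_ge0 _ hnV) leey.
  - by rewrite in_itv/= mule_ge0 ?leey// lee_fin ltW.
  exact: (HM g kg x Gx).2.
rewrite Mq poweRM ?poweR_ge0//; last by apply: integral_ge0 => x _; exact: poweR_ge0.
rewrite -poweRrM mulfV ?gt_eqF// poweRe1 ?lee_fin ?(ltW M0)//.
by apply: lee_wpmul2l => //; rewrite lee_fin ltW.
Qed.
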